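(* Let $A$ be an Auslander regular algebra with Coxeter matrix $C_A$ (with respect to any ordering of the simple $A$-modules). Then the permanent of $C_A$ is $1$ or $-1$.
   Context: Algebras are finite-dimensional quiver algebras (a path algebra of a finite quiver over a field $K$ modulo an admissible ideal), with primitive idempotents $e_1,\dots,e_n$ corresponding to the vertices; modules are finitely generated right modules. Let $0\to A\to I^0\to I^1\to\cdots$ be a minimal injective coresolution of $A$. $A$ is Auslander regular if $\operatorname{pdim} I^i\le i$ for all $i\ge 0$, $\operatorname{idim} A<\infty$, and $A$ has finite global dimension. The Cartan matrix $\omega_A$ is the $n\times n$ matrix with $(i,j)$ entry $\dim_K e_jAe_i$. If $A$ has finite global dimension, $\omega_A$ is invertible over $\mathbb Z$ and the Coxeter matrix is the integer matrix $C_A=-\omega_A^T\omega_A^{-1}$. The permanent of an $n\times n$ matrix $M=(m_{i,j})$ is $\sum_{\sigma\in S_n}\prod_{i=1}^n m_{i,\sigma(i)}$. *)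

(* Defs.v *)
From HB Require Import structures.
From mathcomp Require Import all_boot all_order all_fingroup all_algebra all_field.
From mathcomp Require Import finmap.
From mathcomp.multinomials Require Import monalg.

Set Implicit Arguments.
Unset Strict Implicit.
Unset Printing Implicit Defensive.

Import GRing.Theory.
Local Open Scope fset_scope.
Local Open Scope ring_scope.

Record quiver := Quiver {
  vertex : finType;
  arrow : finType;
  source : arrow -> vertex;
  target : arrow -> vertex }.

Section Paths.
Variable Q : quiver.

Fixpoint is_walk (v : vertex Q) (s : seq (arrow Q)) : bool :=
  if s is a :: s' then (source a == v) && is_walk (target a) s' else true.

(* A path is its starting vertex together with its list of arrows; the vertex
   is only needed to tell the trivial paths apart. *)
Record qpath := QPath {
  qpath_val : vertex Q * seq (arrow Q);
  qpathP : is_walk qpath_val.1 qpath_val.2 }.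
HB.instance Definition _ := [isSub for qpath_val].
HB.instance Definition _ := [Choice of qpath by <:].

Definition qstart (p : qpath) : vertex Q := (qpath_val p).1.
Definition qarrows (p : qpath) : seq (arrow Q) := (qpath_val p).2.
Definition qend (p : qpath) : vertex Q :=
  last (qstart p) (map (@target Q) (qarrows p)).
Definition qlength (p : qpath) : nat := size (qarrows p).

Definition qtriv (v : vertex Q) : qpath := @QPath (v, [::]) (erefl true).

(* Concatenation "first p, then q"; None when the end of p is not the start
   of q. *)
Definition qcomp (p q : qpath) : option qpath :=
  if qend p == qstart q then insub (qstart p, qarrows p ++ qarrows q)
  else None.

Lemma is_walk_cat v s t :
  is_walk v (s ++ t)
  = is_walk v s && is_walk (last v (map (@target Q) s)) t.
Proof. by elim: s v => //= a s IHs v; rewrite IHs andbA. Qed.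

Lemma qcomp_SomeP p q r : (qcomp p q = Some r) <->
  (qend p = qstart q /\ qpath_val r = (qstart p, qarrows p ++ qarrows q)).
Proof.
rewrite /qcomp; split.
  by case: eqP => // pq; case: insubP => // u _ uE [<-].
case=> -> rE; rewrite eqxx; case: insubP => [u _ uE|].
  by congr Some; apply: val_inj; rewrite uE -rE.
by rewrite -rE (valP r).
Qed.

Lemma qcomp_total p q : qend p = qstart q -> exists r, qcomp p q = Some r.
Proof.
move=> pq; have w : is_walk (qstart p) (qarrows p ++ qarrows q).
  by rewrite is_walk_cat (valP p) -/(qend p) pq (valP q).
by exists (@QPath (qstart p, qarrows p ++ qarrows q) w); apply/qcomp_SomeP.
Qed.

Lemma qcomp_start p q r : qcomp p q = Some r -> qstart r = qstart p.
Proof. by case/qcomp_SomeP => _; rewrite /qstart => ->. Qed.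

Lemma qcomp_arrows p q r :
  qcomp p q = Some r -> qarrows r = qarrows p ++ qarrows q.
Proof. by case/qcomp_SomeP => _; rewrite /qarrows => ->. Qed.

Lemma qcomp_end p q r : qcomp p q = Some r -> qend r = qend q.
Proof.
case/qcomp_SomeP=> pq rE.
by rewrite /qend {1}/qstart {1}/qarrows rE /= map_cat last_cat -/(qend p) pq.
Qed.

Lemma qcompA p q r :
  obind (qcomp p) (qcomp q r) = obind (fun x => qcomp x r) (qcomp p q).
Proof.
have [pq|pq] := eqVneq (qend p) (qstart q); last first.
  rewrite [qcomp p q]/qcomp (negPf pq) /=.
  case E: (qcomp q r) => [x|] //=.
  by rewrite /qcomp (qcomp_start E) (negPf pq).
have [qr|qr] := eqVneq (qend q) (qstart r); last first.
  rewrite [qcomp q r]/qcomp (negPf qr) /=.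
  case E: (qcomp p q) => [x|] //=.
  by rewrite /qcomp (qcomp_end E) (negPf qr).
have [x E] := qcomp_total pq; have [y F] := qcomp_total qr.
rewrite E F /=.
have [z G] : exists z, qcomp p y = Some z.
  by apply: qcomp_total; rewrite (qcomp_start F).
rewrite G; apply/esym/qcomp_SomeP; rewrite (qcomp_end E); split=> //.
have [_ ->] := proj1 (qcomp_SomeP _ _ _) G.
by rewrite (qcomp_start E) (qcomp_arrows E) (qcomp_arrows F) catA.
Qed.

Lemma qcomp1p v p : qcomp (qtriv v) p = if v == qstart p then Some p else None.
Proof.
case: eqP => [->|vp]; last by rewrite /qcomp /qend /=; case: eqP.
by apply/qcomp_SomeP; split=> //; case: p => -[].
Qed.

Lemma qcompp1 v p : qcomp p (qtriv v) = if qend p == v then Some p else None.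
Proof.
case: eqP => [<-|vp]; last by rewrite /qcomp [qstart (qtriv v)]/=; case: eqP.
by apply/qcomp_SomeP; split=> //; rewrite /= cats0; case: p => -[].
Qed.

End Paths.

Section BilinearAssoc.
Variables (K : fieldType) (V : lmodType K) (T : Type) (b : T -> V).
Variable mul : V -> V -> V.
Hypothesis mulDl : left_distributive mul +%R.
Hypothesis mulDr : right_distributive mul +%R.
Hypothesis mulZl : forall c x y, mul (c *: x) y = c *: mul x y.
Hypothesis mulZr : forall c x y, mul x (c *: y) = c *: mul x y.
Hypothesis span_b :
  forall x, exists r (c : T -> K), x = \sum_(p <- r) c p *: b p.

Lemma bilinear_suml (J : Type) (r : seq J) (F : J -> V) y :
  mul (\sum_(i <- r) F i) y = \sum_(i <- r) mul (F i) y.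
Proof.
apply: (big_morph (mul^~ y)) => [x z|]; first exact: mulDl.
by rewrite -(scale0r (0 : V)) mulZl !scale0r.
Qed.

Lemma bilinear_sumr (J : Type) (r : seq J) (F : J -> V) x :
  mul x (\sum_(i <- r) F i) = \sum_(i <- r) mul x (F i).
Proof.
apply: (big_morph (mul x)) => [y z|]; first exact: mulDr.
by rewrite -(scale0r (0 : V)) mulZr !scale0r.
Qed.

Lemma bilinear_assoc :
  (forall p q t, mul (b p) (mul (b q) (b t)) = mul (mul (b p) (b q)) (b t)) ->
  associative mul.
Proof.
move=> bA x y z.
have [r1 [c1 ->]] := span_b x.
rewrite !bilinear_suml; apply: eq_bigr => p _; rewrite !mulZl; congr (_ *: _).
have [r2 [c2 ->]] := span_b y.
rewrite bilinear_suml !bilinear_sumr bilinear_suml.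
apply: eq_bigr => q _; rewrite !(mulZl, mulZr); congr (_ *: _).
have [r3 [c3 ->]] := span_b z.
rewrite !bilinear_sumr; apply: eq_bigr => t _.
by rewrite !mulZr bA.
Qed.

End BilinearAssoc.

(* The K-linear combinations of paths. *)
Definition path_algebra (K : fieldType) (Q : quiver) : Type :=
  {malg K[qpath Q]}.

Section PathAlgebra.
Variables (K : fieldType) (Q : quiver).
Local Notation PA := (path_algebra K Q).
HB.instance Definition _ := GRing.Lmodule.on PA.

Definition pa_path (p : qpath Q) : PA := << p >>.

Definition pa_opath (o : option (qpath Q)) : PA := oapp pa_path 0 o.

Definition pa_mul (x y : PA) : PA :=
  \sum_(p <- msupp x) \sum_(q <- msupp y)
    (x@_p * y@_q) *: pa_opath (qcomp p q).

Definition pa_idem (v : vertex Q) : PA := pa_path (qtriv v).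

Definition pa_one : PA := \sum_v pa_idem v.

Lemma pa_mulw (d1 d2 : {fset qpath Q}) (x y : PA) :
  msupp x `<=` d1 -> msupp y `<=` d2 ->
  pa_mul x y = \sum_(p <- d1) \sum_(q <- d2)
    (x@_p * y@_q) *: pa_opath (qcomp p q).
Proof.
move=> le1 le2; rewrite /pa_mul (big_fset_incl _ le1) /=.
  apply/eq_bigr => p _; apply/big_fset_incl => // q _ /mcoeff_outdom ->.
  by rewrite mulr0 scale0r.
move=> p _ /mcoeff_outdom xp.
by rewrite big1 // => q _; rewrite xp mul0r scale0r.
Qed.

Lemma pa_mulDl : left_distributive pa_mul +%R.
Proof.
move=> x y z; pose d := msupp x `|` msupp y.
rewrite (@pa_mulw d (msupp z) (x + y)) ?msuppD_le ?fsubset_refl //.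
rewrite (@pa_mulw d (msupp z) x) ?fsubsetUl ?fsubset_refl //.
rewrite (@pa_mulw d (msupp z) y) ?fsubsetUr ?fsubset_refl //.
rewrite -big_split /=; apply/eq_bigr => p _.
rewrite -big_split /=; apply/eq_bigr => q _.
by rewrite mcoeffD mulrDl scalerDl.
Qed.

Lemma pa_mulDr : right_distributive pa_mul +%R.
Proof.
move=> z x y; pose d := msupp x `|` msupp y.
rewrite (@pa_mulw (msupp z) d z (x + y)) ?msuppD_le ?fsubset_refl //.
rewrite (@pa_mulw (msupp z) d z x) ?fsubsetUl ?fsubset_refl //.
rewrite (@pa_mulw (msupp z) d z y) ?fsubsetUr ?fsubset_refl //.
rewrite -big_split /=; apply/eq_bigr => p _.
rewrite -big_split /=; apply/eq_bigr => q _.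
by rewrite mcoeffD mulrDr scalerDl.
Qed.

Lemma pa_mul0l : left_zero 0 pa_mul.
Proof. by move=> x; rewrite /pa_mul msupp0 big_seq_fset0. Qed.

Lemma pa_mul0r : right_zero 0 pa_mul.
Proof.
by move=> x; rewrite /pa_mul big1 // => p _; rewrite msupp0 big_seq_fset0.
Qed.

Lemma pa_mulZl c x y : pa_mul (c *: x) y = c *: pa_mul x y.
Proof.
rewrite (@pa_mulw (msupp x) (msupp y)) ?msuppZ_le ?fsubset_refl //.
rewrite scaler_sumr; apply/eq_bigr => p _.
rewrite scaler_sumr; apply/eq_bigr => q _.
by rewrite mcoeffZ scalerA mulrA.
Qed.

Lemma pa_mulZr c x y : pa_mul x (c *: y) = c *: pa_mul x y.
Proof.
rewrite (@pa_mulw (msupp x) (msupp y)) ?msuppZ_le ?fsubset_refl //.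
rewrite scaler_sumr; apply/eq_bigr => p _.
rewrite scaler_sumr; apply/eq_bigr => q _.
by rewrite mcoeffZ scalerA mulrCA.
Qed.

Lemma pa_mulU p q : pa_mul (pa_path p) (pa_path q) = pa_opath (qcomp p q).
Proof.
rewrite (@pa_mulw [fset p] [fset q]) ?msuppU_le //.
by rewrite !big_seq_fset1 !mcoeffUU mulr1 scale1r.
Qed.

Lemma pa_expand (x : PA) : x = \sum_(p <- msupp x) x@_p *: pa_path p.
Proof.
rewrite [LHS]monalgE; apply: eq_bigr => p _; apply/malgP => q.
apply: etrans (mcoeffU p _ q) _; rewrite mcoeffZ.
apply: etrans _ (esym (congr1 ( *%R _) (mcoeffU p 1 q))).
by rewrite mulrnAr mulr1.
Qed.

Lemma pa_span (x : PA) :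
  exists r (c : qpath Q -> K), x = \sum_(p <- r) c p *: pa_path p.
Proof. by exists (msupp x : seq _), (fun p => x@_p); apply: pa_expand. Qed.

Lemma pa_mul_suml (J : Type) (r : seq J) (F : J -> PA) y :
  pa_mul (\sum_(i <- r) F i) y = \sum_(i <- r) pa_mul (F i) y.
Proof. exact: (bilinear_suml pa_mulDl pa_mulZl). Qed.

Lemma pa_mul_sumr (J : Type) (r : seq J) (F : J -> PA) x :
  pa_mul x (\sum_(i <- r) F i) = \sum_(i <- r) pa_mul x (F i).
Proof. exact: (bilinear_sumr pa_mulDr pa_mulZr). Qed.

Lemma pa_mulUo p o :
  pa_mul (pa_path p) (pa_opath o) = pa_opath (obind (qcomp p) o).
Proof. by case: o => [q|]; [exact: pa_mulU | exact: pa_mul0r]. Qed.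

Lemma pa_muloU o q :
  pa_mul (pa_opath o) (pa_path q) = pa_opath (obind (fun p => qcomp p q) o).
Proof. by case: o => [p|]; [exact: pa_mulU | exact: pa_mul0l]. Qed.

Lemma pa_mulA : associative pa_mul.
Proof.
apply: (bilinear_assoc pa_mulDl pa_mulDr pa_mulZl pa_mulZr pa_span) => p q t.
apply: (etrans (congr1 (pa_mul _) (pa_mulU q t))).
apply: (etrans (pa_mulUo _ _)); rewrite qcompA -pa_muloU.
exact: (congr1 (pa_mul^~ _) (esym (pa_mulU p q))).
Qed.

Lemma pa_mul1l : left_id pa_one pa_mul.
Proof.
move=> x; rewrite [in LHS](pa_expand x) pa_mul_sumr [RHS](pa_expand x).
apply/eq_bigr => p _; rewrite pa_mulZr; congr (_ *: _).
rewrite pa_mul_suml (bigD1 (qstart p)) //= pa_mulU qcomp1p eqxx /=.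
by rewrite big1 ?addr0 // => v /negPf vp; rewrite pa_mulU qcomp1p vp.
Qed.

Lemma pa_mul1r : right_id pa_one pa_mul.
Proof.
move=> x; rewrite [in LHS](pa_expand x) pa_mul_suml [RHS](pa_expand x).
apply/eq_bigr => p _; rewrite pa_mulZl; congr (_ *: _).
rewrite pa_mul_sumr (bigD1 (qend p)) //= pa_mulU qcompp1 eqxx /=.
rewrite big1 ?addr0 // => v /negPf vp.
by rewrite pa_mulU qcompp1 eq_sym vp.
Qed.

HB.instance Definition _ := GRing.Zmodule_isPzRing.Build PA
  pa_mulA pa_mul1l pa_mul1r pa_mulDl pa_mulDr.

(* J ^ m, for J the ideal generated by the arrows: it has the paths of length
   at least m as a K-basis. *)
Definition in_arrow_ideal_power (m : nat) (x : PA) : Prop :=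
  forall p, p \in msupp x -> (m <= qlength p)%N.

Definition two_sided_ideal (I : PA -> Prop) : Prop :=
  [/\ I 0, forall x y, I x -> I y -> I (x + y),
      forall x y, I x -> I (y * x) & forall x y, I x -> I (x * y)].

Definition admissible_ideal (I : PA -> Prop) : Prop :=
  [/\ two_sided_ideal I,
      forall x, I x -> in_arrow_ideal_power 2 x &
      exists2 m, (2 <= m)%N & forall x, in_arrow_ideal_power m x -> I x].

(* pi induces an isomorphism of K-algebras from KQ / I to A. *)
Definition presents (A : falgType K) (I : PA -> Prop) (pi : {linear PA -> A})
  : Prop :=
  [/\ monoid_morphism pi, forall a, exists x, pi x = a &
      forall x, pi x = 0 <-> I x].

End PathAlgebra.

Section Modules.
Variables (K : fieldType) (A : falgType K).

(* Over a finite-dimensional algebra, a right module is finitely generated if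
   and only if its underlying K-space is finite-dimensional. *)
Record rmodule := RModule {
  rmod_space :> vectType K;
  ract : rmod_space -> A -> rmod_space;
  ract_linearl : forall a, linear (ract^~ a);
  ract_linearr : forall m, linear (ract m);
  ract1 : forall m, ract m 1 = m;
  ractM : forall m a b, ract m (a * b) = ract (ract m a) b }.

Lemma regular_linearl (a : A) : linear (fun m : A => m * a).
Proof. by move=> k x y; rewrite mulrDl scalerAl. Qed.

Lemma regular_linearr (m : A) : linear (fun a : A => m * a).
Proof. by move=> k x y; rewrite mulrDr scalerAr. Qed.

Definition regular_rmodule : rmodule :=
  RModule regular_linearl regular_linearr (@mulr1 A) (@mulrA A).

Definition rmod_hom (M N : rmodule) (f : 'Hom(M, N)) : Prop :=
  forall m a, f (ract m a) = ract (f m) a.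

Definition submodule (M : rmodule) (U : {vspace M}) : Prop :=
  forall m a, m \in U -> ract m a \in U.

Definition projective (P : rmodule) : Prop :=
  forall (X Y : rmodule) (g : 'Hom(X, Y)) (f : 'Hom(P, Y)),
    rmod_hom g -> rmod_hom f -> limg g = fullv ->
    exists2 h : 'Hom(P, X), rmod_hom h & (g \o h)%VF = f.

Definition injective_rmodule (E : rmodule) : Prop :=
  forall (X Y : rmodule) (g : 'Hom(X, Y)) (f : 'Hom(X, E)),
    rmod_hom g -> rmod_hom f -> lker g = 0%VS ->
    exists2 h : 'Hom(Y, E), rmod_hom h & (h \o g)%VF = f.

(* ... -> P 1 -> P 0 -> M -> 0 *)
Record projective_resolution (M : rmodule) (P : nat -> rmodule)
    (d : forall i, 'Hom(P i.+1, P i)) (eps : 'Hom(P 0%N, M)) : Prop := {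
  projres_proj : forall i, projective (P i);
  projres_hom : forall i, rmod_hom (d i);
  projres_hom_eps : rmod_hom eps;
  projres_surj : limg eps = fullv;
  projres_exact0 : limg (d 0%N) = lker eps;
  projres_exact : forall i, limg (d i.+1) = lker (d i) }.

(* 0 -> M -> E 0 -> E 1 -> ... *)
Record injective_coresolution (M : rmodule) (E : nat -> rmodule)
    (eta : 'Hom(M, E 0%N)) (d : forall i, 'Hom(E i, E i.+1)) : Prop := {
  injres_inj : forall i, injective_rmodule (E i);
  injres_hom : forall i, rmod_hom (d i);
  injres_hom_eta : rmod_hom eta;
  injres_ker : lker eta = 0%VS;
  injres_exact0 : limg eta = lker (d 0%N);
  injres_exact : forall i, limg (d i) = lker (d i.+1) }.

Definition essential (M : rmodule) (U : {vspace M}) : Prop :=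
  forall W : {vspace M}, submodule W -> W <> 0%VS -> (W :&: U)%VS <> 0%VS.

(* Minimality: each E i is an injective envelope of the kernel of d i, which
   is the image of the preceding map. *)
Definition minimal_injective_coresolution (M : rmodule) (E : nat -> rmodule)
    (eta : 'Hom(M, E 0%N)) (d : forall i, 'Hom(E i, E i.+1)) : Prop :=
  injective_coresolution eta d /\ forall i, essential (lker (d i)).

Definition pdim_le (M : rmodule) (n : nat) : Prop :=
  exists P d eps, @projective_resolution M P d eps /\
    forall i, (n < i)%N -> \dim {:P i} = 0%N.

Definition idim_le (M : rmodule) (n : nat) : Prop :=
  exists E eta d, @injective_coresolution M E eta d /\
    forall i, (n < i)%N -> \dim {:E i} = 0%N.

Definition finite_global_dimension : Prop :=
  exists n, forall M : rmodule, pdim_le M n.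

(* The minimal injective coresolution exists and is unique up to isomorphism,
   so its terms may be bound existentially. *)
Definition auslander_regular : Prop :=
  [/\ exists E eta d,
        @minimal_injective_coresolution regular_rmodule E eta d /\
        forall i, pdim_le (E i) i,
      exists n, idim_le regular_rmodule n &
      finite_global_dimension].

Definition cartan_matrix (n : nat) (e : 'I_n -> A) : 'M[int]_n :=
  \matrix_(i, j) (\dim (<[e j]> * {:A} * <[e i]>)%VS)%:Z.

Definition coxeter_matrix (n : nat) (e : 'I_n -> A) : 'M[int]_n :=
  - ((cartan_matrix e)^T *m invmx (cartan_matrix e)).

End Modules.

Definition permanent (R : pzRingType) (n : nat) (M : 'M[R]_n) : R :=
  \sum_(s : 'S_n) \prod_i M i (s i).

(* Main.v *)
(** Let P_j = e_j A, let I_i be the injective hull of the simple module S_i, and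
    put d_i = pdim I_i and g_j = idim P_j. Expanding [P_j] = sum_i x_ij [I_i] along
    the minimal injective coresolution of P_j and [I_i] = sum_j z_ji [P_j] along the
    minimal projective resolution of I_i gives mutually inverse integer matrices x
    and z, and the Coxeter matrix is - x^T.

    By Auslander regularity d_i <= k when I_i occurs in degree k of the coresolution
    of P_j. Dually, g_j <= k when P_j occurs in degree k of the resolution of I_i:
    this is the left-right symmetry of the Auslander condition, in the form that a
    module M with top S_j has idim M >= g_j. Indeed, let 0 -> P_j -> J^0 -> ... ->
    J^l -> 0 be the minimal coresolution, l = g_j, and suppose idim M < l. As
    pdim J^l <= l, the functor Ext^l(J^l, -) is right exact, so Ext^l(J^l, S_j) = 0
    as a quotient of Ext^l(J^l, M), and the class of the coresolution in
    Ext^l(J^l, P_j) comes from rad P_j. As pdim J^t <= t, the connecting map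
    Hom(P_j, N) -> Ext^l(J^l, N) is onto for every N; with N = rad P_j, some
    endomorphism r of P_j with image in rad P_j fixes this class. Since r is
    nilpotent the class is zero, so J^l splits off J^(l-1), contradicting minimality.

    Hence x and z are block triangular with respect to d and g, and their diagonal
    blocks are, up to sign, mutually inverse non-negative integer matrices, that is,
    permutation matrices. A single permutation contributes to the permanent. *)

From HB Require Import structures.
Require Import Defs.
From mathcomp Require Import all_boot all_order all_fingroup all_algebra all_field.
From mathcomp Require Import finmap zify.
From mathcomp.multinomials Require Import monalg.
From mathcomp Require boolp.
Import Defs.

Set Implicit Arguments.
Unset Strict Implicit.
Unset Printing Implicit Defensive.

Import Order.TTheory GRing.Theory Num.Theory.
Local Open Scope ring_scope.

(** * Modules, short exact sequences and vanishing of Ext^1 *)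

Section LinearMaps.
Variables (K : fieldType) (U V W : vectType K).

Definition lfun_of (f : U -> V) (fL : linear f) : 'Hom(U, V) :=
  linfun (HB.pack_for {linear U -> V} f (GRing.isLinear.Build K U V _ f fL)).

Lemma lfun_ofE f (fL : linear f) : lfun_of fL =1 f.
Proof. by move=> x; rewrite lfunE. Qed.

Lemma lfun_factor (g : 'Hom(U, V)) (h : 'Hom(U, W)) :
  (forall v, exists u, g u = v) -> (forall u, g u = 0 -> h u = 0) ->
  forall u, (h \o g^-1)%VF (g u) = h u.
Proof.
move=> gS gh u; apply/eqP; rewrite comp_lfunE -subr_eq0 -linearB; apply/eqP.
by apply: gh; rewrite linearB /= limg_lfunVK ?subrr // memv_img ?memvf.
Qed.

Lemma lfun_lift (f : 'Hom(U, V)) (h : 'Hom(W, V)) :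
  (forall w, exists u, f u = h w) -> forall w, f ((f^-1 \o h)%VF w) = h w.
Proof.
move=> fh w; rewrite comp_lfunE limg_lfunVK //.
by have [u <-] := fh w; rewrite memv_img ?memvf.
Qed.

Lemma lfun_injP (f : 'Hom(U, V)) :
  (forall u, f u = 0 -> u = 0) <-> lker f = 0%VS.
Proof.
split=> [fI|/eqP fK u fu]; last first.
  by move/lker0P: fK; apply; rewrite fu linear0.
apply/eqP/lker0P => u v uv; apply/eqP; rewrite -subr_eq0; apply/eqP/fI.
by rewrite linearB /= uv subrr.
Qed.

Lemma lfun_surjP (f : 'Hom(U, V)) :
  (forall v, exists u, f u = v) <-> limg f = fullv.
Proof.
split=> [fS|fF v].
  by apply/vspaceP => v; rewrite memvf; have [u <-] := fS v; rewrite memv_img ?memvf.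
have /memv_imgP[u _ ->]: v \in limg f by rewrite fF memvf.
by exists u.
Qed.

End LinearMaps.

Section Homs.
Variables (K : fieldType) (A : falgType K).
Implicit Types M N L X Y Z P E F Q : rmodule A.

Lemma ractD M (m m' : M) a : ract (m + m') a = ract m a + ract m' a.
Proof. by have := ract_linearl a 1 m m'; rewrite !scale1r. Qed.

Lemma ractZ M k (m : M) a : ract (k *: m) a = k *: ract m a.
Proof.
have r0 : ract (0 : M) a = 0.
  by apply: (addrI (ract (0 : M) a)); rewrite -ractD !addr0.
by have := ract_linearl a k m 0; rewrite !addr0 r0 addr0.
Qed.

Lemma ractDr M (m : M) a b : ract m (a + b) = ract m a + ract m b.
Proof. by have := ract_linearr m 1 a b; rewrite !scale1r. Qed.

Lemma ractZr M k (m : M) a : ract m (k *: a) = k *: ract m a.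
Proof.
have r0 : ract m 0 = 0.
  by apply: (addrI (ract m 0)); rewrite -ractDr !addr0.
by have := ract_linearr m k a 0; rewrite !addr0 r0 addr0.
Qed.

Lemma ract0 M a : ract (0 : M) a = 0.
Proof. by rewrite -[X in ract X](scale0r (0 : M)) ractZ scale0r. Qed.

Lemma ract0r M (m : M) : ract m 0 = 0.
Proof. by rewrite -[X in ract _ X](scale0r (0 : A)) ractZr scale0r. Qed.

Lemma ractN M (m : M) a : ract (- m) a = - ract m a.
Proof. by rewrite -scaleN1r ractZ scaleN1r. Qed.

Lemma ractNr M (m : M) a : ract m (- a) = - ract m a.
Proof. by rewrite -scaleN1r ractZr scaleN1r. Qed.

Lemma ract_suml M (I : Type) (r : seq I) (C : pred I) (F : I -> M) a :
  ract (\sum_(i <- r | C i) F i) a = \sum_(i <- r | C i) ract (F i) a.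
Proof. by apply: (big_morph (fun m => ract m a)) => [x y|]; [exact: ractD | exact: ract0]. Qed.

Lemma ract_sumr M (I : Type) (r : seq I) (C : pred I) (F : I -> A) (m : M) :
  ract m (\sum_(i <- r | C i) F i) = \sum_(i <- r | C i) ract m (F i).
Proof. by apply: (big_morph (ract m)) => [x y|]; [exact: ractDr | exact: ract0r]. Qed.

Definition ract_lfun M (a : A) : 'Hom(M, M) := lfun_of (@ract_linearl _ _ M a).

Lemma ract_lfunE M a (m : M) : ract_lfun M a m = ract m a.
Proof. exact: lfun_ofE. Qed.

Lemma hom_comp M N L (g : 'Hom(N, L)) (f : 'Hom(M, N)) :
  rmod_hom g -> rmod_hom f -> rmod_hom (g \o f)%VF.
Proof. by move=> gH fH m a; rewrite !comp_lfunE fH gH. Qed.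

Lemma hom_id M : rmod_hom (\1%VF : 'Hom(M, M)).
Proof. by move=> m a; rewrite !id_lfunE. Qed.
Arguments hom_id : clear implicits.

Lemma hom_add M N (f g : 'Hom(M, N)) :
  rmod_hom f -> rmod_hom g -> rmod_hom (f + g).
Proof. by move=> fH gH m a; rewrite !add_lfunE fH gH ractD. Qed.

Lemma hom_opp M N (f : 'Hom(M, N)) : rmod_hom f -> rmod_hom (- f).
Proof. by move=> fH m a; rewrite !opp_lfunE fH ractN. Qed.

Lemma hom_sub M N (f g : 'Hom(M, N)) :
  rmod_hom f -> rmod_hom g -> rmod_hom (f - g).
Proof. by move=> fH gH; apply: hom_add => //; apply: hom_opp. Qed.

Lemma hom_zero M N : rmod_hom (0 : 'Hom(M, N)).
Proof. by move=> m a; rewrite !zero_lfunE ract0. Qed.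

Lemma sub_lfunE (U V : vectType K) (f g : 'Hom(U, V)) x : (f - g) x = f x - g x.
Proof. by rewrite add_lfunE opp_lfunE. Qed.

Lemma hom_factor M N L (g : 'Hom(M, N)) (h : 'Hom(M, L)) :
  rmod_hom g -> rmod_hom h -> (forall v, exists u, g u = v) ->
  (forall u, g u = 0 -> h u = 0) ->
  exists2 k : 'Hom(N, L), rmod_hom k & forall u, k (g u) = h u.
Proof.
move=> gH hH gS gh; exists (h \o g^-1)%VF; last exact: lfun_factor.
move=> v a; have [u <-] := gS v.
by rewrite -gH !lfun_factor ?hH.
Qed.

Lemma hom_lift M N L (f : 'Hom(M, N)) (h : 'Hom(L, N)) :
  rmod_hom f -> rmod_hom h -> (forall u, f u = 0 -> u = 0) ->
  (forall w, exists u, f u = h w) ->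
  exists2 k : 'Hom(L, M), rmod_hom k & forall w, f (k w) = h w.
Proof.
move=> fH hH fI fh; exists (f^-1 \o h)%VF; last exact: lfun_lift.
move=> v a; apply/eqP; rewrite -subr_eq0; apply/eqP/fI; rewrite linearB /=.
by rewrite fH !lfun_lift ?hH ?subrr.
Qed.

Record ses X Y Z (f : 'Hom(X, Y)) (g : 'Hom(Y, Z)) : Prop := Ses {
  ses_homl : rmod_hom f;
  ses_homr : rmod_hom g;
  ses_inj : forall x, f x = 0 -> x = 0;
  ses_comp : forall x, g (f x) = 0;
  ses_ex : forall y, g y = 0 -> exists x, f x = y;
  ses_surj : forall z, exists y, g y = z }.

Lemma proj_lift P M N (g : 'Hom(M, N)) (f : 'Hom(P, N)) :
  projective P -> rmod_hom g -> rmod_hom f -> (forall v, exists u, g u = v) ->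
  exists2 h : 'Hom(P, M), rmod_hom h & forall x, g (h x) = f x.
Proof.
move=> PP gH fH /lfun_surjP gS; have [h hH hE] := PP _ _ _ _ gH fH gS.
by exists h => // x; rewrite -comp_lfunE hE.
Qed.

Lemma inj_ext E M N (g : 'Hom(M, N)) (f : 'Hom(M, E)) :
  injective_rmodule E -> rmod_hom g -> rmod_hom f ->
  (forall u, g u = 0 -> u = 0) ->
  exists2 h : 'Hom(N, E), rmod_hom h & forall x, h (g x) = f x.
Proof.
move=> EI gH fH /lfun_injP gI; have [h hH hE] := EI _ _ _ _ gH fH gI.
by exists h => // x; rewrite -comp_lfunE hE.
Qed.

Lemma projectiveP P :
  (forall M N (g : 'Hom(M, N)) (f : 'Hom(P, N)), rmod_hom g -> rmod_hom f ->
   (forall v, exists u, g u = v) ->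
   exists2 h : 'Hom(P, M), rmod_hom h & forall x, g (h x) = f x) ->
  projective P.
Proof.
move=> PP M N g f gH fH /lfun_surjP gS; have [h hH hE] := PP _ _ _ _ gH fH gS.
by exists h => //; apply/lfunP => x; rewrite comp_lfunE hE.
Qed.

Lemma injectiveP E :
  (forall M N (g : 'Hom(M, N)) (f : 'Hom(M, E)), rmod_hom g -> rmod_hom f ->
   (forall u, g u = 0 -> u = 0) ->
   exists2 h : 'Hom(N, E), rmod_hom h & forall x, h (g x) = f x) ->
  injective_rmodule E.
Proof.
move=> EI M N g f gH fH /lfun_injP gI; have [h hH hE] := EI _ _ _ _ gH fH gI.
by exists h => //; apply/lfunP => x; rewrite comp_lfunE hE.
Qed.

(** The lifts of f b1 and f b2 add up along the given decomposition of the identity. With two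
    summands, this is the form in which [schanuel] exhibits [X] as a summand of X' + Y. *)
Lemma projective_retract P P1 P2 (a1 : 'Hom(P, P1)) (b1 : 'Hom(P1, P))
    (a2 : 'Hom(P, P2)) (b2 : 'Hom(P2, P)) :
  rmod_hom a1 -> rmod_hom b1 -> rmod_hom a2 -> rmod_hom b2 ->
  (forall x, x = b1 (a1 x) + b2 (a2 x)) ->
  projective P1 -> projective P2 -> projective P.
Proof.
move=> a1H b1H a2H b2H E PP1 PP2; apply: projectiveP => M N g f gH fH gS.
have [h1 h1H h1E] := proj_lift PP1 gH (hom_comp fH b1H) gS.
have [h2 h2H h2E] := proj_lift PP2 gH (hom_comp fH b2H) gS.
exists ((h1 \o a1) + (h2 \o a2))%VF; first by apply: hom_add; apply: hom_comp.
move=> x; rewrite add_lfunE !comp_lfunE linearD /= h1E h2E !comp_lfunE.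
by rewrite -linearD -E.
Qed.

Lemma injective_retract P P1 (a1 : 'Hom(P, P1)) (b1 : 'Hom(P1, P)) :
  rmod_hom a1 -> rmod_hom b1 -> (forall x, b1 (a1 x) = x) ->
  injective_rmodule P1 -> injective_rmodule P.
Proof.
move=> a1H b1H E PI1; apply: injectiveP => M N g f gH fH gI.
have [h hH hE] := inj_ext PI1 gH (hom_comp a1H fH) gI.
exists (b1 \o h)%VF; first exact: hom_comp.
by move=> x; rewrite comp_lfunE hE comp_lfunE E.
Qed.

Section Schanuel.
Variables (X Y Z Y' X' : rmodule A).
Variables (f : 'Hom(X, Y)) (g : 'Hom(Y, Z)) (f' : 'Hom(X', Y')) (g' : 'Hom(Y', Z)).
Hypotheses (S : ses f g) (S' : ses f' g') (PY : projective Y) (PY' : projective Y').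

(** The half of Schanuel's lemma that makes [X] a summand of X' + Y: the map 1 - l k on [Y] lands in
    the kernel of [g], hence defines [c], which corrects b a to the identity. *)
Lemma schanuel : exists (a : 'Hom(X, X')) (b : 'Hom(X', X)) (c : 'Hom(Y, X)),
  [/\ rmod_hom a, rmod_hom b, rmod_hom c & forall x, x = b (a x) + c (f x)].
Proof.
have [k kH kE] := proj_lift PY (ses_homr S') (ses_homr S) (ses_surj S').
have [l lH lE] := proj_lift PY' (ses_homr S) (ses_homr S') (ses_surj S).
have kf := hom_comp kH (ses_homl S); have lf := hom_comp lH (ses_homl S').
have [x|a aH aE] := hom_lift (ses_homl S') kf (ses_inj S').
  by apply: (ses_ex S'); rewrite comp_lfunE kE (ses_comp S).
have [x|b bH bE] := hom_lift (ses_homl S) lf (ses_inj S).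
  by apply: (ses_ex S); rewrite comp_lfunE lE (ses_comp S').
have dH : rmod_hom (\1 - (l \o k))%VF by apply: hom_sub; [exact: hom_id | exact: hom_comp].
have [y|c cH cE] := hom_lift (ses_homl S) dH (ses_inj S).
  by apply: (ses_ex S); rewrite sub_lfunE id_lfunE comp_lfunE linearB /= lE kE subrr.
exists a, b, c; split=> // x; apply/eqP; rewrite -subr_eq0; apply/eqP/(ses_inj S).
rewrite linearB linearD /= bE cE sub_lfunE !comp_lfunE id_lfunE aE comp_lfunE.
by rewrite addrC [_ + (_ - _)]addrC subrK addNr.
Qed.
End Schanuel.

(** Ext^1(Y, M) = 0 in terms of maps: the pushout along [h] of a sequence ending in [Y] is an
    extension of [Y] by [M], and it splits exactly when [h] extends. *)
Definition ext1_zero Y M : Prop := forall X Z (f : 'Hom(X, Z)) (g : 'Hom(Z, Y)) (h : 'Hom(X, M)),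
  ses f g -> rmod_hom h -> exists2 k : 'Hom(Z, M), rmod_hom k & forall x, k (f x) = h x.

Lemma ext1_injective Y M : injective_rmodule M -> ext1_zero Y M.
Proof.
by move=> MI X Z f g h S hH; apply: inj_ext => //; [exact: ses_homl S | exact: ses_inj S].
Qed.

Lemma ext1_projective Y M : projective Y -> ext1_zero Y M.
Proof.
move=> PY X Z f g h S hH.
have [s sH sE] := proj_lift PY (ses_homr S) (hom_id Y) (ses_surj S).
have dH : rmod_hom (\1 - (s \o g))%VF.
  by apply: hom_sub; [exact: hom_id | exact: hom_comp sH (ses_homr S)].
have [y|c cH cE] := hom_lift (ses_homl S) dH (ses_inj S).
  by apply: (ses_ex S); rewrite sub_lfunE id_lfunE comp_lfunE linearB /= sE id_lfunE subrr.
exists (h \o c)%VF; first exact: hom_comp.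
move=> x; rewrite comp_lfunE; congr (h _); apply/eqP; rewrite -subr_eq0.
apply/eqP/(ses_inj S); rewrite linearB /= cE sub_lfunE comp_lfunE id_lfunE.
by rewrite (ses_comp S) linear0 subr0 subrr.
Qed.

Lemma ext1_retract Y M N (a : 'Hom(M, N)) (b : 'Hom(N, M)) :
  rmod_hom a -> rmod_hom b -> (forall x, b (a x) = x) -> ext1_zero Y N -> ext1_zero Y M.
Proof.
move=> aH bH ba EN X Z f g h S hH.
have [k kH kE] := EN _ _ _ _ _ S (hom_comp aH hH).
exists (b \o k)%VF; first exact: hom_comp.
by move=> x; rewrite comp_lfunE kE comp_lfunE ba.
Qed.

(** By Ext^1(Y, M) = 0 a map Y' -> M extends to [F] and then lifts to [Q], so Hom(Y', Q) -> Hom(Y',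
    M) is onto and Ext^1(Y', X') embeds in Ext^1(Y', Q). *)
Lemma ext1_shift Y' F Y X' Q M (i : 'Hom(Y', F)) (p : 'Hom(F, Y))
    (u : 'Hom(X', Q)) (v : 'Hom(Q, M)) :
  ses i p -> ses u v -> projective F -> ext1_zero Y M -> ext1_zero Y' Q -> ext1_zero Y' X'.
Proof.
move=> S T PF EM EQ X Z f g h R hH.
have [e eH eE] := EQ _ _ _ _ _ R (hom_comp (ses_homl T) hH).
have [x fx|w wH wE] := hom_factor (ses_homr R) (hom_comp (ses_homr T) eH) (ses_surj R).
  have [y <-] := ses_ex R fx.
  by rewrite comp_lfunE eE comp_lfunE (ses_comp T).
have [w' w'H w'E] := EM _ _ _ _ _ S wH.
have [t tH tE] := proj_lift PF (ses_homr T) w'H (ses_surj T).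
have dH : rmod_hom (e - (t \o i \o g))%VF.
  by apply: hom_sub; last exact: hom_comp (hom_comp tH (ses_homl S)) (ses_homr R).
have [z|c cH cE] := hom_lift (ses_homl T) dH (ses_inj T).
  apply: (ses_ex T); rewrite sub_lfunE !comp_lfunE linearB /= tE w'E wE.
  by rewrite comp_lfunE subrr.
exists c => // x; apply/eqP; rewrite -subr_eq0; apply/eqP/(ses_inj T).
rewrite linearB /= cE sub_lfunE !comp_lfunE eE comp_lfunE (ses_comp R) !linear0.
by rewrite addr0 subrr.
Qed.

End Homs.
Arguments hom_id {K A} M m a.

(** * Submodules, powers and free modules *)

Section Constructions.
Variables (K : fieldType) (A : falgType K).
Implicit Types M N L X Y Z P E Q : rmodule A.

Section Sub.
Variables (M : rmodule A) (U : {vspace M}) (hU : submodule U).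

Definition sub_act (x : subvs_of U) (a : A) : subvs_of U := vsproj U (ract (vsval x) a).

Lemma sub_actE x a : vsval (sub_act x a) = ract (vsval x) a.
Proof. by rewrite /sub_act vsprojK //; apply: hU; apply: subvsP. Qed.

Lemma sub_act_linl a : linear (sub_act^~ a).
Proof.
move=> k x y; apply: subvs_inj; rewrite linearP /= !sub_actE.
by rewrite linearP /= ractD ractZ.
Qed.

Lemma sub_act_linr x : linear (sub_act x).
Proof. by move=> k a b; apply: subvs_inj; rewrite linearP /= !sub_actE ractDr ractZr. Qed.

Lemma sub_act1 x : sub_act x 1 = x.
Proof. by apply: subvs_inj; rewrite sub_actE ract1. Qed.

Lemma sub_actM x a b : sub_act x (a * b) = sub_act (sub_act x a) b.
Proof. by apply: subvs_inj; rewrite !sub_actE ractM. Qed.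

Definition subrmod : rmodule A := RModule sub_act_linl sub_act_linr sub_act1 sub_actM.

Definition sub_incl : 'Hom(subrmod, M) := linfun (vsval : subvs_of U -> M).

Lemma sub_inclE (x : subrmod) : sub_incl x = vsval x.
Proof. by rewrite lfunE. Qed.

Lemma sub_incl_hom : rmod_hom sub_incl.
Proof. by move=> x a; rewrite !sub_inclE; apply: sub_actE. Qed.

Lemma sub_incl_inj (x : subrmod) : sub_incl x = 0 -> x = 0.
Proof. by rewrite sub_inclE => x0; apply: subvs_inj; rewrite x0 linear0. Qed.

Lemma sub_incl_mem (x : subrmod) : sub_incl x \in U.
Proof. by rewrite sub_inclE subvsP. Qed.

Lemma sub_incl_ex m : m \in U -> exists x : subrmod, sub_incl x = m.
Proof. by move=> mU; exists (vsproj U m); rewrite sub_inclE vsprojK. Qed.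

Lemma limg_sub_incl : limg sub_incl = U.
Proof.
apply/vspaceP => m; apply/idP/idP => [/memv_imgP[x _ ->]|/sub_incl_ex[x <-]].
  exact: sub_incl_mem.
by rewrite memv_img ?memvf.
Qed.

End Sub.

Section Finfun.
Variables (T : finType) (N : rmodule A).

Definition ff_act (x : {ffun T -> N}) (a : A) : {ffun T -> N} := [ffun t => ract (x t) a].

Lemma ff_act_linl a : linear (ff_act^~ a).
Proof. by move=> k x y; apply/ffunP => t; rewrite !ffunE ractD ractZ. Qed.

Lemma ff_act_linr x : linear (ff_act x).
Proof. by move=> k a b; apply/ffunP => t; rewrite !ffunE ractDr ractZr. Qed.

Lemma ff_act1 x : ff_act x 1 = x.
Proof. by apply/ffunP => t; rewrite !ffunE ract1. Qed.

Lemma ff_actM x a b : ff_act x (a * b) = ff_act (ff_act x a) b.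
Proof. by apply/ffunP => t; rewrite !ffunE ractM. Qed.

Definition ffmod : rmodule A := RModule ff_act_linl ff_act_linr ff_act1 ff_actM.

End Finfun.

Local Notation d := (\dim {:A}).
Local Notation b := (vbasis {:A}).

Section Free.
Variable X : rmodule A.

(** The family [x] stands for the sum of the x_i tensor b_i; [a] acts on the right factor, and b_i a
    is expanded again in the basis. *)
Definition free_act (x : {ffun 'I_d -> X}) (a : A) : {ffun 'I_d -> X} :=
  [ffun k => \sum_(i < d) coord b k (b`_i * a) *: x i].

Lemma free_act_linl a : linear (free_act^~ a).
Proof.
move=> c x y; apply/ffunP => k; rewrite !ffunE scaler_sumr -big_split /=.
by apply: eq_bigr => i _; rewrite !ffunE scalerDr !scalerA mulrC.
Qed.

Lemma free_act_linr x : linear (free_act x).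
Proof.
move=> c a a'; apply/ffunP => k; rewrite !ffunE scaler_sumr -big_split /=.
apply: eq_bigr => i _.
by rewrite mulrDr -scalerAr linearP /= scalerDl scalerA.
Qed.

Lemma vbasisE (a : A) : a = \sum_(i < d) coord b i a *: b`_i.
Proof. by apply: coord_vbasis; rewrite memvf. Qed.

Lemma coord_vbasisE (i k : 'I_d) : coord b k b`_i = (i == k)%:R.
Proof. by rewrite coord_free // (basis_free (vbasisP _)). Qed.

Lemma free_act1 x : free_act x 1 = x.
Proof.
apply/ffunP => k; rewrite ffunE (bigD1 k) //= mulr1 coord_vbasisE eqxx scale1r.
by rewrite big1 ?addr0 // => i ik; rewrite mulr1 coord_vbasisE (negPf ik) scale0r.
Qed.

Lemma free_actM x a a' : free_act x (a * a') = free_act (free_act x a) a'.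
Proof.
apply/ffunP => k; rewrite !ffunE.
under [RHS]eq_bigr => l _ do rewrite ffunE scaler_sumr.
rewrite exchange_big /=; apply: eq_bigr => i _.
under [RHS]eq_bigr => l _ do rewrite scalerA.
rewrite -scaler_suml; congr (_ *: _).
rewrite mulrA [b`_i * a in LHS]vbasisE mulr_suml linear_sum /=.
by apply: eq_bigr => l _; rewrite -scalerAl linearZ /= mulrC.
Qed.

(* X tensored with A over K, the basis of A indexing the components. *)
Definition freemod : rmodule A := RModule free_act_linl free_act_linr free_act1 free_actM.

Definition free_mu_fun (x : freemod) : X := \sum_(i < d) ract ((x : {ffun _ -> _}) i) b`_i.

Lemma free_mu_lin : linear free_mu_fun.
Proof.
move=> c x y; rewrite /free_mu_fun scaler_sumr -big_split /=; apply: eq_bigr => i _.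
by rewrite !ffunE ractD ractZ.
Qed.

Definition free_mu : 'Hom(freemod, X) := lfun_of free_mu_lin.

Lemma free_muE (x : freemod) : free_mu x = \sum_(i < d) ract ((x : {ffun _ -> _}) i) b`_i.
Proof. by rewrite lfun_ofE. Qed.

Lemma free_mu_hom : rmod_hom free_mu.
Proof.
move=> x a; rewrite !free_muE ract_suml.
under eq_bigr => k _ do rewrite ffunE ract_suml.
rewrite exchange_big /=; apply: eq_bigr => i _.
rewrite -ractM [b`_i * a in RHS]vbasisE ract_sumr.
by apply: eq_bigr => k _; rewrite ractZ ractZr.
Qed.

Definition free_unit_fun (x : X) : freemod := [ffun k => coord b k 1 *: x].

Lemma free_unit_lin : linear free_unit_fun.
Proof. by move=> c x y; apply/ffunP => k; rewrite !ffunE scalerDr !scalerA mulrC. Qed.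

Definition free_unit : 'Hom(X, freemod) := lfun_of free_unit_lin.

Lemma free_muK x : free_mu (free_unit x) = x.
Proof.
rewrite free_muE lfun_ofE -[RHS]ract1 [1]vbasisE ract_sumr.
by apply: eq_bigr => i _; rewrite ffunE ractZ ractZr.
Qed.

Lemma free_expand (x : freemod) :
  x = \sum_(i < d) ract (free_unit ((x : {ffun _ -> _}) i)) b`_i.
Proof.
apply/ffunP => k; rewrite sum_ffunE.
under eq_bigr => i _ do rewrite ffunE.
transitivity (\sum_(i < d) coord b k b`_i *: (x : {ffun _ -> _}) i).
  rewrite (bigD1 k) //= coord_vbasisE eqxx scale1r.
  by rewrite big1 ?addr0 // => i ik; rewrite coord_vbasisE (negPf ik) scale0r.
apply: eq_bigr => i _.
under eq_bigr => l _ do rewrite lfun_ofE ffunE scalerA.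
rewrite -scaler_suml; congr (_ *: _).
rewrite -[b`_i in LHS]mul1r [1 in LHS]vbasisE mulr_suml linear_sum /=.
by apply: eq_bigr => l _; rewrite -scalerAl linearZ /= mulrC.
Qed.

End Free.

Section FreeMap.
Variables (X Y : rmodule A) (f : 'Hom(X, Y)).

Definition free_map_fun (x : freemod X) : freemod Y :=
  [ffun k => f ((x : {ffun _ -> _}) k)].

Lemma free_map_lin : linear free_map_fun.
Proof. by move=> c x y; apply/ffunP => k; rewrite !ffunE linearP. Qed.

Definition free_map : 'Hom(freemod X, freemod Y) := lfun_of free_map_lin.

Lemma free_mapE x k : (free_map x : {ffun _ -> _}) k = f ((x : {ffun _ -> _}) k).
Proof. by rewrite lfun_ofE ffunE. Qed.

Lemma free_map_hom : rmod_hom free_map.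
Proof.
move=> x a; apply/ffunP => k; rewrite free_mapE !ffunE linear_sum.
by apply: eq_bigr => i _; rewrite linearZ /= free_mapE.
Qed.

Lemma free_map_mu : rmod_hom f -> forall x, free_mu Y (free_map x) = f (free_mu X x).
Proof.
move=> fH x; rewrite !free_muE linear_sum /=.
by apply: eq_bigr => i _; rewrite free_mapE fH.
Qed.

Lemma free_map_inj : (forall x, f x = 0 -> x = 0) -> forall x, free_map x = 0 -> x = 0.
Proof.
move=> fI x x0; apply/ffunP => k; rewrite ffunE; apply: fI.
by rewrite -free_mapE x0 ffunE.
Qed.

End FreeMap.

Lemma free_map_comp X Y Z (g : 'Hom(Y, Z)) (f : 'Hom(X, Y)) x :
  free_map (g \o f)%VF x = free_map g (free_map f x).
Proof. by apply/ffunP => k; rewrite !free_mapE comp_lfunE. Qed.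

Lemma free_map_id X x : free_map (\1%VF : 'Hom(X, X)) x = x.
Proof. by apply/ffunP => k; rewrite free_mapE id_lfunE. Qed.

Lemma free_map_add X Y (f g : 'Hom(X, Y)) x :
  free_map (f + g) x = free_map f x + free_map g x.
Proof. by apply/ffunP => k; rewrite ffunE !free_mapE add_lfunE. Qed.

Lemma free_map_ex X Y (f : 'Hom(X, Y)) y :
  (forall k, exists x, f x = (y : {ffun _ -> _}) k) -> exists x, free_map f x = y.
Proof.
move=> fy; exists (free_map f^-1%VF y); apply/ffunP => k; rewrite !free_mapE.
by rewrite limg_lfunVK //; have [x <-] := fy k; rewrite memv_img ?memvf.
Qed.

(** A module map out of X tensor A amounts to a linear map out of [X], so [f] need only be lifted
    linearly, by [g^-1], on the elements x tensor 1. *)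
Lemma freemod_projective X : projective (freemod X).
Proof.
apply: projectiveP => M N g f gH fH gS.
pose l := (g^-1 \o f \o free_unit X)%VF.
exists (free_mu M \o free_map l)%VF.
  by apply: hom_comp; [exact: free_mu_hom | exact: free_map_hom].
move=> x; rewrite comp_lfunE free_muE linear_sum /= [in RHS](free_expand x) linear_sum /=.
apply: eq_bigr => i _; rewrite gH fH free_mapE; congr (ract _ _).
rewrite /l !comp_lfunE limg_lfunVK //.
by have [u <-] := gS (f (free_unit X ((x : {ffun _ -> _}) i))); rewrite memv_img ?memvf.
Qed.

End Constructions.

(** * Functorial syzygies *)

Section Syzygies.
Variables (K : fieldType) (A : falgType K).
Implicit Types M N L X Y Z P E F Q : rmodule A.

Lemma lker_submodule M N (f : 'Hom(M, N)) : rmod_hom f -> submodule (lker f).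
Proof. by move=> fH m a; rewrite !memv_ker fH => /eqP->; rewrite ract0. Qed.

Lemma limg_submodule M N (f : 'Hom(M, N)) : rmod_hom f -> submodule (limg f).
Proof. by move=> fH m a /memv_imgP[x _ ->]; rewrite -fH memv_img ?memvf. Qed.

(** Using the canonical cover X tensor A -> X instead of a minimal one makes the syzygy an additive
    exact functor, with maps defined on the nose and not only modulo projectives. *)
Definition syz X : rmodule A := subrmod (lker_submodule (@free_mu_hom _ _ X)).

Definition syz_incl X : 'Hom(syz X, freemod X) :=
  sub_incl (lker_submodule (@free_mu_hom _ _ X)).

Lemma syz_ses X : ses (syz_incl X) (free_mu X).
Proof.
split; [exact: sub_incl_hom | exact: free_mu_hom | exact: sub_incl_inj | | | ].
- by move=> x; apply/eqP; rewrite -memv_ker; apply: sub_incl_mem.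
- by move=> y /eqP; rewrite -memv_ker => yk; apply: sub_incl_ex.
- by move=> x; exists (free_unit X x); rewrite free_muK.
Qed.

Fact syz_map_key : unit. Proof. by []. Qed.
Definition syz_map X Y (f : 'Hom(X, Y)) : 'Hom(syz X, syz Y) :=
  locked_with syz_map_key ((syz_incl Y)^-1 \o (free_map f \o syz_incl X))%VF.

Lemma syz_mapE X Y (f : 'Hom(X, Y)) x : rmod_hom f ->
  syz_incl Y (syz_map f x) = free_map f (syz_incl X x).
Proof.
move=> fH; rewrite [syz_map f]unlock lfun_lift ?comp_lfunE // => w.
apply: (ses_ex (syz_ses Y)); rewrite comp_lfunE free_map_mu //.
by rewrite (ses_comp (syz_ses X)) linear0.
Qed.

Lemma syz_incl_inj X : injective (syz_incl X).
Proof.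
move=> x y xy; apply/eqP; rewrite -subr_eq0; apply/eqP/(ses_inj (syz_ses X)).
by rewrite linearB /= xy subrr.
Qed.

Lemma syz_map_hom X Y (f : 'Hom(X, Y)) : rmod_hom f -> rmod_hom (syz_map f).
Proof.
move=> fH x a; apply: syz_incl_inj; rewrite syz_mapE // !(ses_homl (syz_ses _)).
by rewrite free_map_hom syz_mapE.
Qed.

Lemma syz_map_comp X Y Z (g : 'Hom(Y, Z)) (f : 'Hom(X, Y)) :
  rmod_hom g -> rmod_hom f -> syz_map (g \o f)%VF = (syz_map g \o syz_map f)%VF.
Proof.
move=> gH fH; apply/lfunP => x; apply: syz_incl_inj; have gfH := hom_comp gH fH.
by rewrite syz_mapE // comp_lfunE !syz_mapE // free_map_comp.
Qed.

Lemma syz_map_add X Y (f g : 'Hom(X, Y)) :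
  rmod_hom f -> rmod_hom g -> syz_map (f + g) = syz_map f + syz_map g.
Proof.
move=> fH gH; apply/lfunP => x; apply: syz_incl_inj.
rewrite syz_mapE; last exact: hom_add.
by rewrite add_lfunE linearD /= !syz_mapE // free_map_add.
Qed.

Lemma syz_map_id X : syz_map (\1%VF : 'Hom(X, X)) = \1%VF.
Proof.
apply/lfunP => x; apply: syz_incl_inj; rewrite id_lfunE syz_mapE ?free_map_id //.
exact: hom_id.
Qed.

(** [freemod] is exact because it is componentwise; the kernels of three compatible surjections
    between exact sequences then form an exact sequence. *)
Lemma syz_map_ses X Y Z (f : 'Hom(X, Y)) (g : 'Hom(Y, Z)) :
  ses f g -> ses (syz_map f) (syz_map g).
Proof.
move=> S; have fH := ses_homl S; have gH := ses_homr S.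
split; [exact: syz_map_hom | exact: syz_map_hom | | | |].
- move=> x x0; apply: (ses_inj (syz_ses X)); apply: (free_map_inj (ses_inj S)).
  by rewrite -syz_mapE // x0 linear0.
- move=> x; apply: syz_incl_inj; rewrite !syz_mapE // -free_map_comp linear0.
  by apply/ffunP => k; rewrite free_mapE comp_lfunE ffunE (ses_comp S).
- move=> y y0; have /free_map_ex[x xE] k : exists x, f x = (syz_incl Y y : {ffun _ -> _}) k.
    by apply: (ses_ex S); rewrite -free_mapE -syz_mapE // y0 linear0 ffunE.
  have [x' x'E] : exists x', syz_incl X x' = x.
    apply: (ses_ex (syz_ses X)); apply: (ses_inj S).
    by rewrite -free_map_mu // xE (ses_comp (syz_ses Y)).
  by exists x'; apply: syz_incl_inj; rewrite syz_mapE // x'E.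
- move=> z; have /free_map_ex[y yE] k : exists y, g y = (syz_incl Z z : {ffun _ -> _}) k.
    exact: (ses_surj S).
  (* The lift [y] need not lie in the syzygy of [Y]. Its image under [free_mu] comes from [X], and
     subtracting a lift [x1] of that element repairs this. *)
  have [x xE] : exists x, f x = free_mu Y y.
    apply: (ses_ex S).
    by rewrite -free_map_mu // yE (ses_comp (syz_ses Z)).
  have [x1 x1E] := ses_surj (syz_ses X) x.
  have [y' y'E] : exists y', syz_incl Y y' = y - free_map f x1.
    apply: (ses_ex (syz_ses Y)).
    by rewrite linearB /= free_map_mu // x1E xE subrr.
  exists y'; apply: syz_incl_inj; rewrite syz_mapE // y'E linearB /= yE.
  rewrite -free_map_comp [X in _ - X](_ : _ = 0) ?subr0 //.
  by apply/ffunP => k; rewrite free_mapE comp_lfunE ffunE (ses_comp S).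
Qed.

Lemma syz_projective P : projective P -> projective (syz P).
Proof.
move=> PP; have S := syz_ses P.
have [s sH sE] := proj_lift PP (ses_homr S) (hom_id P) (ses_surj S).
have dH : rmod_hom (\1 - (s \o free_mu P))%VF.
  by apply: hom_sub; [exact: hom_id | exact: hom_comp sH (ses_homr S)].
have [y|c cH cE] := hom_lift (ses_homl S) dH (ses_inj S).
  by apply: (ses_ex S); rewrite sub_lfunE id_lfunE comp_lfunE linearB /= sE id_lfunE subrr.
apply: (@projective_retract _ _ _ (freemod P) (freemod P) (syz_incl P) c 0 0) => //.
- exact: (ses_homl S).
- exact: hom_zero.
- exact: hom_zero.
- move=> x; rewrite !zero_lfunE addr0; apply: syz_incl_inj.
  by rewrite cE sub_lfunE comp_lfunE id_lfunE (ses_comp S) linear0 subr0.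
- exact: freemod_projective.
- exact: freemod_projective.
Qed.

Fixpoint nsyz t X : rmodule A := if t is t'.+1 then nsyz t' (syz X) else X.

Fixpoint nsyz_map t X Y (f : 'Hom(X, Y)) : 'Hom(nsyz t X, nsyz t Y) :=
  match t return 'Hom(nsyz t X, nsyz t Y) with
  | 0 => f
  | t'.+1 => nsyz_map t' (syz_map f)
  end.

Lemma nsyz_map_hom t X Y (f : 'Hom(X, Y)) : rmod_hom f -> rmod_hom (nsyz_map t f).
Proof. by elim: t X Y f => //= t IH X Y f fH; apply: IH; apply: syz_map_hom. Qed.

Lemma nsyz_map_comp t X Y Z (g : 'Hom(Y, Z)) (f : 'Hom(X, Y)) :
  rmod_hom g -> rmod_hom f -> nsyz_map t (g \o f)%VF = (nsyz_map t g \o nsyz_map t f)%VF.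
Proof.
elim: t X Y Z g f => //= t IH X Y Z g f gH fH.
by rewrite syz_map_comp // IH //; apply: syz_map_hom.
Qed.

Lemma nsyz_map_add t X Y (f g : 'Hom(X, Y)) :
  rmod_hom f -> rmod_hom g -> nsyz_map t (f + g) = nsyz_map t f + nsyz_map t g.
Proof.
elim: t X Y f g => //= t IH X Y f g fH gH.
by rewrite syz_map_add // IH //; apply: syz_map_hom.
Qed.

Lemma nsyz_map_id t X : nsyz_map t (\1%VF : 'Hom(X, X)) = \1%VF.
Proof. by elim: t X => //= t IH X; rewrite syz_map_id IH. Qed.

Lemma nsyz_map_ses t X Y Z (f : 'Hom(X, Y)) (g : 'Hom(Y, Z)) :
  ses f g -> ses (nsyz_map t f) (nsyz_map t g).
Proof. by elim: t X Y Z f g => //= t IH X Y Z f g S; apply: IH; apply: syz_map_ses. Qed.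

Lemma nsyz_projective t P : projective P -> projective (nsyz t P).
Proof. by elim: t P => //= t IH P PP; apply: IH; apply: syz_projective. Qed.

Lemma nsyz_free_projective t X : projective (nsyz t (freemod X)).
Proof. by apply: nsyz_projective; apply: freemod_projective. Qed.

Lemma nsyz_ses t X : ses (nsyz_map t (syz_incl X)) (nsyz_map t (free_mu X)).
Proof. exact: nsyz_map_ses (syz_ses X). Qed.

(** pdim X <= t: by Schanuel, projectivity of the t-th syzygy does not depend on the chosen
    resolution. *)
Definition pdim_bound t X := projective (nsyz t X).
(* idim M <= t, because Ext^1(nsyz t X, M) = Ext^(t+1)(X, M). *)
Definition idim_bound t M := forall X, ext1_zero (nsyz t X) M.

Lemma nsyz_add s t X : nsyz (s + t) X = nsyz s (nsyz t X).
Proof.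
elim: t X => [|t IH] X; first by rewrite addn0.
by rewrite addnS /= IH.
Qed.

Lemma pdim_bound_le s t X : (s <= t)%N -> pdim_bound s X -> pdim_bound t X.
Proof.
move=> /subnKC <-; rewrite addnC /pdim_bound; elim: (t - s)%N => // k IH PX.
have -> : (k.+1 + s = 1 + (k + s))%N by rewrite addSn.
by rewrite nsyz_add; apply: syz_projective; apply: IH.
Qed.

Lemma idim_bound_le s t M : (s <= t)%N -> idim_bound s M -> idim_bound t M.
Proof. by move=> /subnKC <- IM X; rewrite nsyz_add; apply: IM. Qed.

Lemma idim_bound_injective M : injective_rmodule M -> idim_bound 0 M.
Proof. by move=> MI X; apply: ext1_injective. Qed.

Lemma idim_bound_retract t M N (a : 'Hom(M, N)) (b : 'Hom(N, M)) :
  rmod_hom a -> rmod_hom b -> (forall x, b (a x) = x) -> idim_bound t N -> idim_bound t M.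
Proof. by move=> aH bH ba IN X; apply: ext1_retract ba (IN X). Qed.

Lemma idim_bound_shift t X Q M (u : 'Hom(X, Q)) (v : 'Hom(Q, M)) :
  ses u v -> idim_bound t M -> idim_bound t.+1 Q -> idim_bound t.+1 X.
Proof.
move=> S IM IQ Y.
by apply: (ext1_shift (nsyz_ses t Y) S); [exact: nsyz_free_projective | | exact: IQ].
Qed.

Lemma pdim_idim_bound D : (forall X, pdim_bound D X) -> forall M, idim_bound D M.
Proof. by move=> PD M X; apply: ext1_projective; apply: PD. Qed.

(** The additive functor [nsyz t] preserves the decomposition of the identity. *)
Lemma pdim_bound_sum t X X1 X2 (a1 : 'Hom(X, X1)) (b1 : 'Hom(X1, X))
    (a2 : 'Hom(X, X2)) (b2 : 'Hom(X2, X)) :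
  rmod_hom a1 -> rmod_hom b1 -> rmod_hom a2 -> rmod_hom b2 ->
  (forall x, x = b1 (a1 x) + b2 (a2 x)) -> pdim_bound t X1 -> pdim_bound t X2 -> pdim_bound t X.
Proof.
move=> a1H b1H a2H b2H E P1 P2.
have E' : ((b1 \o a1) + (b2 \o a2))%VF = \1%VF.
  by apply/lfunP => x; rewrite id_lfunE [RHS]E add_lfunE !comp_lfunE.
refine (projective_retract (nsyz_map_hom (t := t) a1H) (nsyz_map_hom (t := t) b1H)
  (nsyz_map_hom (t := t) a2H) (nsyz_map_hom (t := t) b2H) _ P1 P2) => x.
have := congr1 (fun f : 'Hom(_, _) => f x) (nsyz_map_id t X).
rewrite -E' nsyz_map_add; try exact: hom_comp.
rewrite !nsyz_map_comp //= id_lfunE add_lfunE !comp_lfunE => H; exact: esym H.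
Qed.

Lemma pdim_bound_retract t X Y (a : 'Hom(X, Y)) (b : 'Hom(Y, X)) :
  rmod_hom a -> rmod_hom b -> (forall x, b (a x) = x) -> pdim_bound t Y -> pdim_bound t X.
Proof.
move=> aH bH ba PY.
apply: (@pdim_bound_sum t X Y Y a b 0 0) => //; try exact: hom_zero.
by move=> x; rewrite !zero_lfunE addr0 ba.
Qed.

Lemma pdim_bound_projective t P : projective P -> pdim_bound t P.
Proof. by move=> PP; apply: (@pdim_bound_le 0). Qed.

(** Schanuel's lemma compares the given presentation of [Z] with the free one: each kernel is a
    summand of the other plus a projective. *)
Lemma pdim_bound_step t X Y Z (f : 'Hom(X, Y)) (g : 'Hom(Y, Z)) :
  ses f g -> projective Y -> pdim_bound t X <-> pdim_bound t.+1 Z.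
Proof.
move=> S PY; have S' := syz_ses Z; have PF := @freemod_projective _ _ Z.
split=> [PX|PZ].
  have [a [b [c [aH bH cH E]]]] := schanuel S' S PF PY.
  by apply: (pdim_bound_sum aH bH (ses_homl S') cH E PX); apply: pdim_bound_projective.
have [a [b [c [aH bH cH E]]]] := schanuel S S' PY PF.
by apply: (pdim_bound_sum aH bH (ses_homl S) cH E PZ); apply: pdim_bound_projective.
Qed.

Lemma lker_ses M N (f : 'Hom(M, N)) (fH : rmod_hom f) :
  (forall y, exists x, f x = y) -> ses (sub_incl (lker_submodule fH)) f.
Proof.
move=> fS; split=> //; [exact: sub_incl_hom | exact: sub_incl_inj | |].
- by move=> x; apply/eqP; rewrite -memv_ker; apply: sub_incl_mem.
- by move=> y /eqP; rewrite -memv_ker => yk; apply: sub_incl_ex.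
Qed.

Lemma dim0_eq0 (V : vectType K) : \dim {:V} = 0%N -> forall x : V, x = 0.
Proof. by move=> /eqP; rewrite dimv_eq0 => /eqP V0 x; apply/eqP; rewrite -memv0 -V0 memvf. Qed.

Lemma pdim_le_bound M n : pdim_le M n -> pdim_bound n M.
Proof.
case=> P [d [eps [R P0]]].
elim: n M P d eps R P0 => [|n IH] M P d eps R P0.
  have eH := projres_hom_eps R.
  have eS : forall v, exists u, eps u = v by apply/lfun_surjP; exact: projres_surj R.
  (* As [P 1] vanishes, [eps] is an isomorphism. *)
  have eI : forall u, eps u = 0 -> u = 0.
    apply/lfun_injP; rewrite -(projres_exact0 R); apply/eqP.
    rewrite -subv0; apply/subvP => _ /memv_imgP[x _ ->].
    by rewrite (dim0_eq0 (P0 1%N isT) x) linear0 mem0v.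
  have [|k kH kE] := hom_factor eH (hom_id (P 0%N)) eS.
    by move=> u /eI; rewrite id_lfunE.
  apply: (@pdim_bound_retract 0 _ (P 0%N) k eps) => //; last exact: projres_proj R 0%N.
  by move=> x; have [u <-] := eS x; rewrite kE id_lfunE.
have eH := projres_hom_eps R.
have eS : forall v, exists u, eps u = v by apply/lfun_surjP; exact: projres_surj R.
have PP := projres_proj R. have HH := projres_hom R.
refine (proj1 (pdim_bound_step n (lker_ses eH eS) (PP 0%N)) _).
set X := subrmod _; pose i := sub_incl (lker_submodule eH) : 'Hom(X, P 0%N).
have iH : rmod_hom i by exact: sub_incl_hom.
have iI : forall x, i x = 0 -> x = 0 by exact: sub_incl_inj.
(* The kernel of [eps] is resolved by the shifted complex, with the corestriction of [d 0] as
   augmentation. *)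
have [x|e' e'H e'E] := hom_lift iH (HH 0%N) iI.
  by apply: sub_incl_ex; rewrite -(projres_exact0 R) memv_img ?memvf.
apply: (IH X (fun i => P i.+1) (fun i => d i.+1) e'); last by move=> j jn; apply: P0.
split=> //.
- apply/lfun_surjP => x.
  have : i x \in limg (d 0%N) by rewrite (projres_exact0 R) sub_incl_mem.
  case/memv_imgP => u _ uE; exists u; apply/eqP; rewrite -subr_eq0; apply/eqP/iI.
  by rewrite linearB /= e'E uE subrr.
- rewrite (projres_exact R); apply/vspaceP => x; rewrite !memv_ker -e'E.
  by apply/eqP/eqP => [/iI|->]; rewrite ?linear0.
- by move=> j; exact: (projres_exact R).
Qed.

End Syzygies.

(** * Iterated connecting maps along a coresolution *)

Section Null.
Variables (K : fieldType) (A : falgType K).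
Implicit Types M N X Y : rmodule A.

(* phi represents zero in Ext^t(X, N), the cocycles being the maps from the
   t-th syzygy of X to N. *)
Definition null t X N : 'Hom(nsyz t X, N) -> Prop :=
  match t with
  | 0 => fun phi => phi = 0
  | t'.+1 => fun phi => exists2 e : 'Hom(nsyz t' (freemod X), N),
      rmod_hom e & (e \o nsyz_map t' (syz_incl X))%VF = phi
  end.
Arguments null : clear implicits.

Lemma null_comp t X N M (h : 'Hom(N, M)) (phi : 'Hom(nsyz t X, N)) :
  rmod_hom h -> null t X N phi -> null t X M (h \o phi)%VF.
Proof.
case: t phi => [|t] phi hH /= => [->|[e eH <-]]; first by rewrite comp_lfun0r.
by exists (h \o e)%VF; [exact: hom_comp | rewrite comp_lfunA].
Qed.

Lemma null_add t X N (phi psi : 'Hom(nsyz t X, N)) :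
  null t X N phi -> null t X N psi -> null t X N (phi + psi).
Proof.
case: t phi psi => [|t] phi psi /= => [-> ->|[e eH <-] [e' e'H <-]].
  by rewrite addr0.
by exists (e + e'); [exact: hom_add | rewrite comp_lfunDl].
Qed.

Lemma nullS t X N (e : 'Hom(nsyz t (freemod X), N)) :
  rmod_hom e -> null t.+1 X N (e \o nsyz_map t (syz_incl X))%VF.
Proof. by move=> eH; exists e. Qed.

End Null.
Arguments null {K A}.

Section Ladder.
Variables (K : fieldType) (A : falgType K) (B J : nat -> rmodule A).
Variables (f : forall t, 'Hom(B t, J t)) (g : forall t, 'Hom(J t, B t.+1)).
Hypotheses (S : forall t, ses (f t) (g t)) (JI : forall t, injective_rmodule (J t)).

(** [k t] lifts the free cover of [B t.+1] to [J t]; its restriction [c t] to the syzygy is a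
    cocycle for the class of the t-th sequence in Ext^1(B t.+1, B t). *)
Variables (k : forall t, 'Hom(freemod (B t.+1), J t)).
Variables (c : forall t, 'Hom(syz (B t.+1), B t)).
Hypotheses (kH : forall t, rmod_hom (k t)) (cH : forall t, rmod_hom (c t)).
Hypothesis kE : forall t, (g t \o k t)%VF = free_mu (B t.+1).
Hypothesis cE : forall t, (f t \o c t)%VF = (k t \o syz_incl (B t.+1))%VF.
Implicit Types X N M : rmodule A.

Let fH t : rmod_hom (f t) := ses_homl (S t).
Let gH t : rmod_hom (g t) := ses_homr (S t).
Let iH X : rmod_hom (syz_incl X) := ses_homl (syz_ses X).
Let muH X : rmod_hom (free_mu X) := ses_homr (syz_ses X).

(* Postcomposition with theta t is the iterated connecting map
   Hom(B 0, N) -> Ext^t(B t, N) of the sequences 0 -> B s -> J s -> B s.+1 -> 0. *)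
Fixpoint theta t : 'Hom(nsyz t (B t), B 0%N) :=
  match t with
  | 0 => \1%VF
  | t'.+1 => (theta t' \o nsyz_map t' (c t'))%VF
  end.

Lemma theta_hom t : rmod_hom (theta t).
Proof.
elim: t => [|t IH] /=; first exact: hom_id.
by apply: hom_comp IH _; apply: nsyz_map_hom.
Qed.

(** Composition with [c] induces a connecting map on cohomology, so it has to preserve
    coboundaries. *)
Lemma null_theta_step t N (nu : 'Hom(nsyz t (B t), N)) :
  null t (B t) N nu -> null t.+1 (B t.+1) N (nu \o nsyz_map t (c t))%VF.
Proof.
case: t nu => [|t] nu.
  by move=> /= ->; exists 0; [exact: hom_zero | rewrite !comp_lfun0l].
case=> e eH <-; set t1 := t.+1.
(* The linear inverse of [f t1] becomes a module map on free covers, so [r] extends the inclusion of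
   the syzygy of [B t1] to the syzygy of [J t1]. With [cE] this moves the coboundary onto the free
   cover of [B t1.+1]. *)
pose r := (free_map (f t1)^-1 \o syz_incl (J t1))%VF.
have rH : rmod_hom r by apply: hom_comp; [exact: free_map_hom | exact: iH].
have rE : (r \o syz_map (f t1))%VF = syz_incl (B t1).
  apply/lfunP => x; rewrite !comp_lfunE syz_mapE // -free_map_comp.
  rewrite lker0_compVf ?free_map_id //.
  by apply/eqP/lfun_injP/(ses_inj (S t1)).
have iB : nsyz_map t (syz_incl (B t1)) = (nsyz_map t r \o nsyz_map t1 (f t1))%VF.
  by rewrite -rE nsyz_map_comp //; apply: syz_map_hom.
exists (e \o nsyz_map t r \o nsyz_map t1 (k t1))%VF.
  by apply: hom_comp; [apply: hom_comp => //|]; apply: nsyz_map_hom.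
rewrite iB -!comp_lfunA; congr (_ \o (_ \o _))%VF.
by rewrite -[LHS]nsyz_map_comp // -cE nsyz_map_comp.
Qed.

(* As Ext^(s+1)(J s, N) = 0 for s < t, the iterated connecting map
   Hom(B 0, N) -> Ext^t(B t, N) is onto: precomposition with C is a section. *)
Lemma theta_section t : (forall s, (s < t)%N -> pdim_bound s (J s)) ->
  exists2 C : 'Hom(B 0%N, nsyz t (B t)), rmod_hom C &
    null t (B t) _ (\1 - (C \o theta t))%VF.
Proof.
elim: t => [|t IH] PJ.
  by exists \1%VF; [exact: hom_id | rewrite /= comp_lfun1l subrr].
have [s st|C CH CE] := IH; first by apply: PJ; rewrite ltnS ltnW.
have R := nsyz_map_ses t (S t); have R' := nsyz_ses t (B t.+1).
set f' := nsyz_map t (f t) in R; set g' := nsyz_map t (g t) in R.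
set i' := nsyz_map t (syz_incl _) in R'; set mu' := nsyz_map t (free_mu _) in R'.
pose k' := nsyz_map t (k t); pose c' := nsyz_map t (c t).
have k'H : rmod_hom k' by exact: nsyz_map_hom.
have c'H : rmod_hom c' by exact: nsyz_map_hom.
have gk : (g' \o k')%VF = mu' by rewrite -nsyz_map_comp // kE.
have fc : (f' \o c')%VF = (k' \o i')%VF by rewrite -!nsyz_map_comp // cE.
(* As [nsyz t (J t)] is projective, [a] lifts g' through mu'. It induces [d] on the kernels, and [h]
   is a homotopy between a k' and the identity. *)
have [a aH aE] := proj_lift (PJ t (ltnSn t)) (ses_homr R') (ses_homr R) (ses_surj R').
have afH := hom_comp aH (ses_homl R).
have [x|d dH dE] := hom_lift (ses_homl R') afH (ses_inj R').
  by apply: (ses_ex R'); rewrite comp_lfunE aE (ses_comp R).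
have akH : rmod_hom (\1 - (a \o k'))%VF.
  by apply: hom_sub; [exact: hom_id | exact: hom_comp].
have [x|h hH hE] := hom_lift (ses_homl R') akH (ses_inj R').
  apply: (ses_ex R'); rewrite sub_lfunE id_lfunE comp_lfunE linearB /= aE.
  by rewrite -gk comp_lfunE subrr.
exists (d \o C)%VF; first exact: hom_comp.
(* Since d c' = 1 - h i', the difference is a coboundary plus the inductive difference transported
   by [d] and c'. *)
have -> : (\1 - ((d \o C) \o theta t.+1))%VF =
    (h \o i')%VF + (d \o ((\1 - (C \o theta t)) \o c'))%VF :> 'Hom(_, _).
  apply/lfunP => x; rewrite [RHS]add_lfunE.
  have -> : (h \o i')%VF x = x - d (c' x).
    apply/eqP; rewrite -subr_eq0; apply/eqP/(ses_inj R').
    rewrite !linearB /= comp_lfunE hE sub_lfunE id_lfunE dE.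
    by rewrite !comp_lfunE -[f' (c' x)]comp_lfunE fc comp_lfunE -opprD subrr.
  rewrite /= sub_lfunE id_lfunE !comp_lfunE sub_lfunE id_lfunE comp_lfunE.
  by rewrite linearB /= addrA subrK.
apply: null_add; first exact: nullS.
by apply: null_comp => //; apply: null_theta_step.
Qed.

(** The extension [e] says that the pullback along [xi] of the t-th sequence splits: k xi - f e
    vanishes on the syzygy and descends to a lift of [xi]. *)
Lemma lift_of_extension t X (xi : 'Hom(X, B t.+1)) (e : 'Hom(freemod X, B t)) :
  rmod_hom xi -> rmod_hom e ->
  (forall x, e (syz_incl X x) = c t (syz_map xi x)) ->
  exists2 z : 'Hom(X, J t), rmod_hom z & forall x, g t (z x) = xi x.
Proof.
move=> xiH eH eE.
have dH : rmod_hom ((k t \o free_map xi) - (f t \o e))%VF.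
  by apply: hom_sub; apply: hom_comp => //; apply: free_map_hom.
have T := syz_ses X.
have [y|z zH zE] := hom_factor (ses_homr T) dH (ses_surj T).
  case/(ses_ex T) => x <-; rewrite sub_lfunE !comp_lfunE eE -syz_mapE //.
  by rewrite -[k t _]comp_lfunE -cE comp_lfunE subrr.
exists z => // x; have [y <-] := ses_surj T x.
rewrite zE sub_lfunE !comp_lfunE linearB /= (ses_comp (S t)) subr0.
by rewrite -[g t _]comp_lfunE kE free_map_mu.
Qed.

(* The iterated connecting map Hom(X, B t.+1) -> Ext^(t+1)(X, B 0) only kills the
   image of Hom(X, J t). *)
Lemma null_lift t X (xi : 'Hom(X, B t.+1)) : rmod_hom xi ->
  null t.+1 X _ (theta t.+1 \o nsyz_map t.+1 xi)%VF ->
  exists2 z : 'Hom(X, J t), rmod_hom z & forall x, g t (z x) = xi x.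
Proof.
elim: t X xi => [|t IH] X xi xiH.
  case=> e eH eE; apply: lift_of_extension eH _ => // x.
  have := congr1 (fun h : 'Hom(_, _) => h x) eE.
  by rewrite /= !comp_lfunE id_lfunE.
pose xi' := (c t.+1 \o syz_map xi)%VF.
have sxH := syz_map_hom xiH; have xi'H : rmod_hom xi' by exact: hom_comp.
have -> : (theta t.+2 \o nsyz_map t.+2 xi)%VF = (theta t.+1 \o nsyz_map t.+1 xi')%VF.
  by rewrite {1}/theta -/theta -comp_lfunA; rewrite [in RHS]/xi' [in RHS]nsyz_map_comp.
case=> e eH eE.
have T := syz_ses (freemod X).
(* [e] is defined over the syzygy of the free cover of [X], while the induction needs the free cover
   of the syzygy. As [freemod X] is projective, [r] retracts its free cover onto its syzygy, and [q]
   carries [e] over. *)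
have [r rH rE] := ext1_projective (@freemod_projective _ _ X) T (hom_id (syz (freemod X))).
pose q := (r \o free_map (syz_incl X))%VF.
have qH : rmod_hom q by apply: hom_comp => //; apply: free_map_hom.
have qE : (q \o syz_incl (syz X))%VF = syz_map (syz_incl X).
  by apply/lfunP => x; rewrite !comp_lfunE -syz_mapE // rE id_lfunE.
have [//||z zH zE] := IH (syz X) xi'.
  exists (e \o nsyz_map t q)%VF; first by apply: hom_comp => //; apply: nsyz_map_hom.
  by rewrite -comp_lfunA -nsyz_map_comp // qE.
(* Injectivity of [J t] extends the lift [z] of xi' to the free cover of [X]; then g w is the
   extension that [lift_of_extension] asks for. *)
have [w wH wE] := inj_ext (@JI t) (@iH X) zH (ses_inj (syz_ses X)).
have gwH := hom_comp (@gH t) wH.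
apply: (lift_of_extension xiH gwH) => x.
by rewrite comp_lfunE wE zE comp_lfunE.
Qed.

Section Splitting.
Variables (l : nat) (M N : rmodule A) (q : 'Hom(M, N)) (p : 'Hom(B 0%N, N)).
Hypotheses (qH : rmod_hom q) (pH : rmod_hom p).
Hypotheses (qS : forall y, exists x, q x = y) (pS : forall y, exists x, p x = y).
Hypothesis p_local : forall r : 'Hom(B 0%N, B 0%N), rmod_hom r ->
  (forall x, p (r x) = 0) -> exists m, forall x, iter m r x = 0.
Hypotheses (PJ : forall s, (s <= l)%N -> pdim_bound s (J s)) (PB : pdim_bound l.+1 (B l.+1)).
Hypothesis IM : idim_bound l M.

(* Ext^(l+1)(B l.+1, -) is right exact, so Ext^(l+1)(B l.+1, N) is a quotient of
   Ext^(l+1)(B l.+1, M) = 0; hence theta is a cocycle with values in the kernel of p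
   up to a coboundary, and r acts on its class as the identity. *)
Lemma theta_null : null l.+1 (B l.+1) _ (theta l.+1).
Proof.
have thH := @theta_hom l.+1; set th := theta l.+1 in thH *.
have [C CH CE] : exists2 C : 'Hom(B 0%N, nsyz l.+1 (B l.+1)), rmod_hom C &
    null l.+1 (B l.+1) _ (\1 - (C \o th))%VF.
  by apply: theta_section => s; rewrite ltnS; apply: PJ.
have R := nsyz_ses l (B l.+1).
(* [y] lifts p th to [M] by projectivity, [w] extends it to the free syzygy because idim M <= l, and
   [s] lifts q w through [p]. Thus s' is a coboundary that agrees with [th] after applying [p]. *)
have [y yH yE] := proj_lift PB qH (hom_comp pH thH) qS.
have [w wH wE] := IM R yH.
have qwH := hom_comp qH wH.
have [s sH sE] := proj_lift (@nsyz_free_projective _ _ l (B l.+1)) pH qwH pS.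
have s0 := nullS sH; set s' := (s \o _)%VF in s0.
have s'H : rmod_hom s' by apply: hom_comp => //; exact: (ses_homl R).
have ps z : p (s' z) = p (th z).
  by rewrite [s' z]comp_lfunE sE comp_lfunE wE yE comp_lfunE.
pose r := ((th - s') \o C)%VF.
have dH : rmod_hom (th - s') by exact: hom_sub.
have rH : rmod_hom r by apply: hom_comp.
have pr x : p (r x) = 0.
  by rewrite [r x]comp_lfunE sub_lfunE linearB /= ps subrr.
have [m rm] := p_local rH pr.
have step : null l.+1 (B l.+1) _ (th - (r \o th))%VF.
  have -> : (th - (r \o th))%VF = (s' + ((th - s') \o (\1 - (C \o th))))%VF :> 'Hom(_, _).
    rewrite comp_lfunDr comp_lfunNr comp_lfun1r addrA [s' + _]addrC subrK.
    by rewrite comp_lfunA.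
  by apply: null_add => //; apply: null_comp.
(* Iterating the previous step, [th] is cohomologous to r^j th for every j, and some r^j is zero. *)
suff H j : exists2 rj : 'Hom(B 0%N, B 0%N), (forall x, rj x = iter j r x) &
    null l.+1 (B l.+1) _ (th - (rj \o th))%VF.
  have [rm' rm'E] := H m.
  have -> : rm' = 0 by apply/lfunP => x; rewrite rm'E rm zero_lfunE.
  by rewrite comp_lfun0l subr0.
elim: j => [|j [rj rjE rjN]].
  exists \1%VF => [x|]; first by rewrite id_lfunE.
  by rewrite comp_lfun1l subrr; exists 0; [exact: hom_zero | rewrite comp_lfun0l].
exists (r \o rj)%VF => [x|]; first by rewrite comp_lfunE rjE.
have -> : (th - ((r \o rj) \o th))%VF = ((th - (r \o th)) + (r \o (th - (rj \o th))))%VF :> 'Hom(_, _).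
  by rewrite comp_lfunDr comp_lfunNr addrA subrK comp_lfunA.
by apply: null_add => //; apply: null_comp.
Qed.

End Splitting.

(** This is [null_lift] for the identity of [B l.+1]. *)
Lemma theta_null_split l : null l.+1 (B l.+1) _ (theta l.+1) ->
  exists2 z : 'Hom(B l.+1, J l), rmod_hom z & forall x, g l (z x) = x.
Proof.
move=> N0; have [|z zH zE] := @null_lift l _ \1%VF (hom_id (B l.+1)).
  by rewrite nsyz_map_id comp_lfun1r.
by exists z => // x; rewrite zE id_lfunE.
Qed.

End Ladder.

Lemma exists_min (P : nat -> Prop) :
  (exists n, P n) -> exists2 n, P n & forall m, P m -> (n <= m)%N.
Proof.
case=> n Pn; elim/ltn_ind: n Pn => n IH Pn.
have [[m [mn Pm]]|noP] := boolp.pselect (exists m, (m < n)%N /\ P m); first exact: IH Pm.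
exists n => // m Pm; rewrite leqNgt; apply/negP => mn.
by apply: noP; exists m.
Qed.

(** * Splitting criteria for injective coresolutions *)

Section Coresolution.
Variables (K : fieldType) (A : falgType K) (B J : nat -> rmodule A).
Variables (f : forall t, 'Hom(B t, J t)) (g : forall t, 'Hom(J t, B t.+1)).
Hypotheses (S : forall t, ses (f t) (g t)) (JI : forall t, injective_rmodule (J t)).

Lemma ladder_exists t :
  exists kc : 'Hom(freemod (B t.+1), J t) * 'Hom(syz (B t.+1), B t),
  [/\ rmod_hom kc.1, rmod_hom kc.2, (g t \o kc.1)%VF = free_mu (B t.+1) &
      (f t \o kc.2)%VF = (kc.1 \o syz_incl (B t.+1))%VF].
Proof.
have T := syz_ses (B t.+1).
have [k kH kE] := proj_lift (@freemod_projective _ _ (B t.+1)) (ses_homr (S t))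
  (ses_homr T) (ses_surj (S t)).
have [x|c cH cE] := hom_lift (ses_homl (S t)) (hom_comp kH (ses_homl T)) (ses_inj (S t)).
  by apply: (ses_ex (S t)); rewrite comp_lfunE kE (ses_comp T).
exists (k, c); split=> //; apply/lfunP => x; first by rewrite comp_lfunE kE.
by rewrite comp_lfunE cE.
Qed.

Let k t := (sval (boolp.cid (ladder_exists t))).1.
Let c t := (sval (boolp.cid (ladder_exists t))).2.
Let kH t : rmod_hom (k t). Proof. by rewrite /k; case: (boolp.cid _) => -[? ?] []. Qed.
Let cH t : rmod_hom (c t). Proof. by rewrite /c; case: (boolp.cid _) => -[? ?] []. Qed.
Let kE t : (g t \o k t)%VF = free_mu (B t.+1).
Proof. by rewrite /k; case: (boolp.cid _) => -[? ?] []. Qed.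
Let cE t : (f t \o c t)%VF = (k t \o syz_incl (B t.+1))%VF.
Proof. by rewrite /k /c; case: (boolp.cid _) => -[? ?] []. Qed.

Lemma coresolution_split l (M N : rmodule A) (q : 'Hom(M, N)) (p : 'Hom(B 0%N, N)) :
  rmod_hom q -> rmod_hom p ->
  (forall y, exists x, q x = y) -> (forall y, exists x, p x = y) ->
  (forall r : 'Hom(B 0%N, B 0%N), rmod_hom r ->
    (forall x, p (r x) = 0) -> exists m, forall x, iter m r x = 0) ->
  (forall s, (s <= l)%N -> pdim_bound s (J s)) -> pdim_bound l.+1 (B l.+1) -> idim_bound l M ->
  exists2 z : 'Hom(B l.+1, J l), rmod_hom z & forall x, g l (z x) = x.
Proof.
move=> qH pH qS pS loc PJ PB IM.
apply: (theta_null_split S JI kH cH kE cE).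
exact (@theta_null _ _ B J f g S k c kH cH kE cE l M N q p qH pH qS pS loc PJ PB IM).
Qed.

(** Under this bound Ext^(l+1)(B l.+1, -) vanishes, so every cocycle is a coboundary. With finite
    global dimension this makes the minimal coresolution stop. *)
Lemma coresolution_split_pdim l : pdim_bound l (B l.+1) ->
  exists2 z : 'Hom(B l.+1, J l), rmod_hom z & forall x, g l (z x) = x.
Proof.
move=> PB; apply: (theta_null_split S JI kH cH kE cE).
have [e eH eE] := ext1_projective PB (nsyz_ses l (B l.+1)) (@theta_hom _ _ B c cH l.+1).
by exists e => //; apply/lfunP => x; rewrite comp_lfunE eE.
Qed.

End Coresolution.

(** * Finite direct sums *)

Section DirectSum.
Variables (K : fieldType) (A : falgType K) (T : finType).
Implicit Types M N X Y Z : rmodule A.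

Record dsum (M : T -> rmodule A) N (i : forall a, 'Hom(M a, N)) (p : forall a, 'Hom(N, M a))
  : Prop := Dsum {
  dsum_homi : forall a, rmod_hom (i a);
  dsum_homp : forall a, rmod_hom (p a);
  dsum_pi : forall a x, p a (i a x) = x;
  dsum_pi0 : forall a b x, a != b -> p b (i a x) = 0;
  dsum_sum : forall x, \sum_a i a (p a x) = x }.

Section Theory.
Variables (M : T -> rmodule A) (N : rmodule A).
Variables (i : forall a, 'Hom(M a, N)) (p : forall a, 'Hom(N, M a)).
Hypothesis S : dsum i p.

Lemma hom_sum X Y (I : Type) (r : seq I) (F : I -> 'Hom(X, Y)) :
  (forall j, rmod_hom (F j)) -> rmod_hom (\sum_(j <- r) F j).
Proof. by move=> FH; apply: big_ind => //; [exact: hom_zero | exact: hom_add]. Qed.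

Lemma dsum_ext x y : (forall a, p a x = p a y) -> x = y.
Proof. by move=> xy; rewrite -(dsum_sum S x) -(dsum_sum S y); apply: eq_bigr => a _; rewrite xy. Qed.

Lemma dsum_ext1 Y : (forall a, ext1_zero Y (M a)) -> ext1_zero Y N.
Proof.
move=> EM X Z f g h R hH.
have /fin_all_exists2[k kH kE] a := EM a _ _ _ _ _ R (hom_comp (@dsum_homp _ _ _ _ S a) hH).
exists (\sum_a (i a \o k a))%VF.
  by apply: hom_sum => a; apply: hom_comp (kH a); apply: (dsum_homi S).
move=> x; rewrite sum_lfunE -[RHS](dsum_sum S); apply: eq_bigr => a _.
by rewrite comp_lfunE kE comp_lfunE.
Qed.

Lemma dsum_idim_bound t : (forall a, idim_bound t (M a)) -> idim_bound t N.
Proof. by move=> IM X; apply: dsum_ext1 => a; apply: IM. Qed.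

Lemma dsum_projective : (forall a, projective (M a)) -> projective N.
Proof.
move=> PM; apply: projectiveP => X Y g f gH fH gS.
have /fin_all_exists2[k kH kE] a :=
  proj_lift (PM a) gH (hom_comp fH (@dsum_homi _ _ _ _ S a)) gS.
exists (\sum_a (k a \o p a))%VF.
  by apply: hom_sum => a; apply: hom_comp (kH a) _; apply: (dsum_homp S).
move=> x; rewrite sum_lfunE linear_sum -[x in RHS](dsum_sum S) linear_sum.
by apply: eq_bigr => a _; rewrite /= comp_lfunE kE comp_lfunE.
Qed.

Lemma dsum_injective : (forall a, injective_rmodule (M a)) -> injective_rmodule N.
Proof.
move=> IM; apply: injectiveP => X Y g f gH fH gI.
have /fin_all_exists2[k kH kE] a :=
  inj_ext (IM a) gH (hom_comp (@dsum_homp _ _ _ _ S a) fH) gI.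
exists (\sum_a (i a \o k a))%VF.
  by apply: hom_sum => a; apply: hom_comp (kH a); apply: (dsum_homi S).
move=> x; rewrite sum_lfunE -[RHS](dsum_sum S); apply: eq_bigr => a _.
by rewrite comp_lfunE kE comp_lfunE.
Qed.

End Theory.

Section Existence.
Variables (L : rmodule A) (V : T -> {vspace L}) (hV : forall a, submodule (V a)).

(** All summands lie in one module [L], so their sum is cut out of the functions T -> L as the image
    of this projection. *)
Definition ffproj_fun (x : ffmod T L) : ffmod T L :=
  [ffun a => projv (V a) ((x : {ffun _ -> _}) a)].

Lemma ffproj_lin : linear ffproj_fun.
Proof. by move=> c x y; apply/ffunP => a; rewrite !ffunE linearP. Qed.

Lemma mem_ffproj (x : ffmod T L) :
  reflect (forall a, (x : {ffun _ -> _}) a \in V a) (x \in limg (lfun_of ffproj_lin)).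
Proof.
apply: (iffP memv_imgP) => [[y _ ->] a|xV].
  by rewrite lfun_ofE ffunE memv_proj.
by exists x; rewrite ?memvf // lfun_ofE; apply/ffunP => a; rewrite ffunE projv_id.
Qed.

Lemma ffproj_submodule : submodule (limg (lfun_of ffproj_lin)).
Proof. by move=> x c /mem_ffproj xV; apply/mem_ffproj => a; rewrite ffunE; apply: hV. Qed.

Definition dsum_mod : rmodule A := subrmod ffproj_submodule.

Definition dsum_in_fun a (x : subrmod (@hV a)) : ffmod T L :=
  [ffun b => if b == a then sub_incl (@hV a) x else 0].

Lemma dsum_in_lin a : linear (@dsum_in_fun a).
Proof.
move=> c x y; apply/ffunP => b; rewrite !ffunE; case: ifP => _; first by rewrite linearP.
by rewrite scaler0 addr0.
Qed.

Lemma dsum_pr_lin a : linear (fun x : ffmod T L => (x : {ffun _ -> _}) a).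
Proof. by move=> c x y; rewrite !ffunE. Qed.

Lemma dsum_exists : exists (i : forall a, 'Hom(subrmod (@hV a), dsum_mod))
  (p : forall a, 'Hom(dsum_mod, subrmod (@hV a))), dsum i p.
Proof.
pose u := sub_incl ffproj_submodule : 'Hom(dsum_mod, ffmod T L).
have uH : rmod_hom u by exact: sub_incl_hom.
have uI x : u x = 0 -> x = 0 by exact: sub_incl_inj.
have uinj : injective u by apply/lker0P/eqP/lfun_injP.
have inE a x b : (lfun_of (@dsum_in_lin a) x : {ffun _ -> _}) b =
    if b == a then sub_incl (@hV a) x else 0.
  by rewrite lfun_ofE ffunE.
have prE a x : lfun_of (@dsum_pr_lin a) x = (x : {ffun _ -> _}) a.
  by rewrite lfun_ofE.
have inH a : rmod_hom (lfun_of (@dsum_in_lin a)).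
  move=> x c; apply/ffunP => b; rewrite inE [RHS]ffunE inE.
  by case: ifP => _; rewrite ?sub_incl_hom ?ract0.
have prH a : rmod_hom (lfun_of (@dsum_pr_lin a)).
  by move=> x c; rewrite !prE ffunE.
have /fin_all_exists2[i iH iE] a : exists2 i : 'Hom(subrmod (@hV a), dsum_mod),
    rmod_hom i & forall x, u (i x) = lfun_of (@dsum_in_lin a) x.
  apply: (hom_lift uH (@inH a) uI) => x; apply: sub_incl_ex; apply/mem_ffproj => b.
  rewrite inE; case: eqP => [->|_]; [exact: sub_incl_mem | exact: mem0v].
have /fin_all_exists2[p pH pE] a : exists2 p : 'Hom(dsum_mod, subrmod (@hV a)),
    rmod_hom p & forall x, sub_incl (@hV a) (p x) = (lfun_of (@dsum_pr_lin a) \o u)%VF x.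
  apply: (hom_lift (@sub_incl_hom _ _ _ _ _) (hom_comp (@prH a) uH)).
    exact: sub_incl_inj.
  move=> x; apply: sub_incl_ex; rewrite comp_lfunE prE.
  by have /mem_ffproj := sub_incl_mem x.
have vinj a : injective (sub_incl (@hV a)).
  by apply/lker0P/eqP/lfun_injP/sub_incl_inj.
exists i, p; split=> //.
- by move=> a x; apply: vinj; rewrite pE comp_lfunE prE iE inE eqxx.
- move=> a b x ab; apply: vinj.
  by rewrite pE comp_lfunE prE iE inE eq_sym (negPf ab) linear0.
- move=> x; apply: uinj; rewrite linear_sum; apply/ffunP => b; rewrite sum_ffunE.
  rewrite (bigD1 b) //= iE inE eqxx pE comp_lfunE prE big1 ?addr0 // => a ab.
  by rewrite iE inE eq_sym (negPf ab).
Qed.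

End Existence.

End DirectSum.

(** * Split basic algebras *)

Section DualRank.
Variables (K : fieldType) (V : vectType K).

Lemma precomp_lin (U W : vectType K) (p : 'Hom(U, W)) :
  linear (fun f : 'Hom(W, K^o) => (f \o p)%VF).
Proof. by move=> c f g; rewrite comp_lfunDl comp_lfunZl. Qed.

(** The rank of a transpose: with [p] factored through its image as i q, precomposition with [i] is
    onto and precomposition with [q] is injective. *)
Lemma dim_limg_precomp (p : 'End(V)) :
  \dim (limg (lfun_of (precomp_lin p))) = \dim (limg p).
Proof.
set W := limg p.
pose q : 'Hom(V, subvs_of W) := (linfun (vsproj W) \o p)%VF.
pose i : 'Hom(subvs_of W, V) := linfun (vsval : subvs_of W -> V).
have iq : (i \o q)%VF = p.
  apply/lfunP => x; rewrite !comp_lfunE !lfunE /= vsprojK //.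
  by rewrite memv_img ?memvf.
have -> : lfun_of (precomp_lin p) = (lfun_of (precomp_lin q) \o lfun_of (precomp_lin i))%VF.
  by apply/lfunP => f; rewrite comp_lfunE !lfun_ofE -comp_lfunA iq.
rewrite limg_comp (_ : limg _ = fullv); last first.
  apply/lfun_surjP => g; exists (g \o linfun (vsproj W))%VF.
  by apply/lfunP => x; rewrite lfun_ofE !comp_lfunE !lfunE /= vsvalK.
rewrite limg_dim_eq; last first.
  rewrite capfv; apply/lfun_injP => g; rewrite lfun_ofE => g0.
  apply/lfunP => x; have /memv_imgP[y _ xE] := subvsP x.
  have := congr1 (fun h : 'Hom(_, _) => h y) g0.
  rewrite !zero_lfunE comp_lfunE => <-; congr (g _).
  by apply: subvs_inj; rewrite comp_lfunE lfunE /= vsprojK ?memv_img ?memvf.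
by rewrite dimvf /= /dim /= muln1.
Qed.

End DualRank.

Section BasicData.
Variables (K : fieldType) (A : falgType K) (n : nat).
Variables (e : 'I_n -> A) (eps : 'I_n -> 'Hom(A, K^o)).

Definition radv := (\bigcap_i lker (eps i))%VS.

(* A split basic algebra: A / rad A is a product of copies of K, with
   coordinates eps i, and the e i lift the idempotents of this product. *)
Record basic : Prop := Basic {
  basic_sum : \sum_i e i = 1;
  basic_mul : forall i j, e i * e j = if i == j then e i else 0;
  basic_eps1 : forall i, eps i 1 = 1;
  basic_epsM : forall i x y, eps i (x * y) = eps i x * eps i y;
  basic_eps_e : forall i j, eps i (e j) = (i == j)%:R;
  basic_nil : exists m, (radv ^+ m.+1 = 0)%VS }.

End BasicData.

Section Basic.
Variables (K : fieldType) (A : falgType K) (n : nat).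
Variables (e : 'I_n -> A) (eps : 'I_n -> 'Hom(A, K^o)).
Hypothesis H : basic e eps.
Let e_sum := basic_sum H.
Let e_mul := basic_mul H.
Let eps1 := basic_eps1 H.
Let epsM := basic_epsM H.
Let eps_e := basic_eps_e H.
Let J_nil := basic_nil H.
Local Notation J := (radv eps).
Implicit Types M N X Y Z B : rmodule A.

Local Notation R := (regular_rmodule A).

Lemma mem_radv x : (x \in J) = [forall i, eps i x == 0].
Proof.
rewrite memvE; apply/subv_bigcapP/forallP => Hx i; first by rewrite -memv_ker memvE Hx.
by move=> _; rewrite -memvE memv_ker.
Qed.

Lemma mem_radvP x : reflect (forall i, eps i x = 0) (x \in J).
Proof. by rewrite mem_radv; apply: (iffP forallP) => Hx i; apply/eqP; apply: Hx. Qed.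

Lemma radv_mull x y : y \in J -> x * y \in J.
Proof. by move/mem_radvP => Hx; apply/mem_radvP => i; rewrite epsM Hx mulr0. Qed.

Lemma radv_el j x : e j * x - eps j x *: e j \in J.
Proof.
apply/mem_radvP => i; rewrite linearB linearZ /= epsM eps_e.
by case: eqVneq => [->|_]; rewrite ?mul1r ?mul0r /GRing.scale /= ?mulr1 ?mulr0 subrr.
Qed.

Lemma radv_er j x : x * e j - eps j x *: e j \in J.
Proof.
apply/mem_radvP => i; rewrite linearB linearZ /= epsM eps_e.
by case: eqVneq => [->|_]; rewrite ?mulr1 ?mulr0 /GRing.scale /= ?mulr1 ?mulr0 subrr.
Qed.

Lemma radv_nilp z : z \in J -> exists m, z ^+ m = 0.
Proof.
move=> zJ; have [m Jm] := J_nil; exists m.+1; apply/eqP; rewrite -memv0 -Jm.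
elim: m {Jm} => [|m IH]; first by rewrite expr1.
by rewrite exprS expvSl memv_mul.
Qed.

Lemma radv_inv z : z \in J -> exists y, (1 - z) * y = 1.
Proof.
case/radv_nilp => m zm; exists (\sum_(i < m) z ^+ i).
by rewrite -opprB mulNr -subrX1 zm sub0r opprK.
Qed.

(* The witness spans a simple submodule of M / U isomorphic to the i-th simple module. *)
Lemma socle M (U : {vspace M}) y : submodule U -> y \notin U ->
  exists i c, [/\ ract y c \notin U, ract (ract y c) (e i) = ract y c &
    forall a, a \in J -> ract (ract y c) a \in U].
Proof.
move=> hU yU.
have [c xU xJ] : exists2 c, ract y c \notin U & forall a, a \in J -> ract (ract y c) a \in U.
  have [m Jm] := J_nil.
  have yJ a : a \in (J ^+ m.+1)%VS -> ract y a \in U.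
    by rewrite Jm memv0 => /eqP->; rewrite ract0r mem0v.
  (* Multiply by radical elements as long as the result can stay outside [U]; the nilpotency
     exponent bounds the number of steps. *)
  elim: m {Jm} y yU yJ => [|m IH] y yU yJ; first by exists 1; rewrite ract1 // => a aJ; apply: yJ.
  have [[a [aJ ya]]|noa] := boolp.pselect (exists a, a \in J /\ ract y a \notin U).
    have [b bJ|c] := IH _ ya; first by rewrite -ractM; apply: yJ; rewrite expvSl memv_mul.
    by rewrite -ractM; exists (a * c).
  by exists 1; rewrite ract1 // => a aJ; apply/negPn/negP => ya; apply: noa; exists a.
set x := ract y c in xU xJ.
have [i xi] : exists i, ract x (e i) \notin U.
  apply/existsP; rewrite -negb_forall; apply: contra xU => /forallP xe.
  by rewrite -[x]ract1 -e_sum ract_sumr memv_suml.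
exists i, (c * e i); rewrite ractM -/x; split=> //; first by rewrite -ractM e_mul eqxx.
by move=> a aJ; rewrite -ractM xJ ?radv_mull.
Qed.

Lemma regular_projective : projective R.
Proof.
apply: projectiveP => M N g f gH fH gS.
have [m mE] := gS (f (1 : A)).
exists (lfun_of (@ract_linearr _ _ M m) : 'Hom(R, M)) => [x a|x].
  by rewrite !lfun_ofE ractM.
rewrite lfun_ofE gH mE -fH; congr (f _).
by rewrite /= mul1r.
Qed.

Definition Pv j : {vspace R} := limg (amull (e j)).

Lemma mem_Pv j (x : A) : (x \in Pv j) = (e j * x == x).
Proof.
apply/memv_imgP/eqP => [[y _ ->]|<-]; first by rewrite lfunE /= mulrA e_mul eqxx.
by exists x; rewrite ?memvf // lfunE.
Qed.

Lemma Pv_submodule j : submodule (Pv j).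
Proof. by move=> x a; rewrite !mem_Pv => /eqP xE; rewrite mulrA xE. Qed.

Definition Pmod j := subrmod (@Pv_submodule j).
Definition Pincl j : 'Hom(Pmod j, R) := sub_incl (@Pv_submodule j).

Lemma Pincl_hom j : rmod_hom (Pincl j). Proof. exact: sub_incl_hom. Qed.

Lemma Pincl_inj j : injective (Pincl j).
Proof. by apply/lker0P/eqP/lfun_injP/sub_incl_inj. Qed.

Lemma Pincl_mul j (x : Pmod j) : e j * (Pincl j x : A) = Pincl j x.
Proof. by apply/eqP; rewrite -mem_Pv; apply: sub_incl_mem. Qed.

Lemma Pincl_ex j (x : A) : e j * x = x -> exists y : Pmod j, Pincl j y = x.
Proof. by move=> xE; apply: sub_incl_ex; rewrite mem_Pv xE. Qed.

Lemma Pmod_retract j : exists2 p : 'Hom(R, Pmod j), rmod_hom p & forall x, p (Pincl j x) = x.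
Proof.
have aH : @rmod_hom _ _ R R (amull (e j)).
  by move=> x a; rewrite !lfunE /= mulrA.
have [x|p pH pE] := hom_lift (@Pincl_hom j) aH (@sub_incl_inj _ _ _ _ (@Pv_submodule j)).
  by apply: Pincl_ex; rewrite lfunE /= mulrA e_mul eqxx.
by exists p => // x; apply: Pincl_inj; rewrite pE lfunE /= Pincl_mul.
Qed.

Lemma Pmod_projective j : projective (Pmod j).
Proof.
have [p pH pE] := Pmod_retract j.
apply: (projective_retract (@Pincl_hom j) pH (@hom_zero _ _ (Pmod j) R) (@hom_zero _ _ R (Pmod j))).
- by move=> x; rewrite pE !zero_lfunE addr0.
- exact: regular_projective.
- exact: regular_projective.
Qed.

Definition S_act j (k : K^o) (a : A) : K^o := k * eps j a.

Lemma S_linl j a : linear ((S_act j)^~ a).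
Proof. by move=> c x y; rewrite /S_act mulrDl -scalerAl. Qed.

Lemma S_linr j x : linear (S_act j x).
Proof. by move=> c a b; rewrite /S_act linearP /= mulrDr -scalerAr. Qed.

Lemma S_act1 j x : S_act j x 1 = x. Proof. by rewrite /S_act eps1 mulr1. Qed.

Lemma S_actM j x a b : S_act j x (a * b) = S_act j (S_act j x a) b.
Proof. by rewrite /S_act epsM mulrA. Qed.

Definition Smod j : rmodule A := RModule (@S_linl j) (@S_linr j) (@S_act1 j) (@S_actM j).

Definition Ptop j : 'Hom(Pmod j, Smod j) := (eps j \o Pincl j)%VF.

Lemma Ptop_hom j : rmod_hom (Ptop j).
Proof. by move=> x a; rewrite !comp_lfunE Pincl_hom [LHS]epsM. Qed.

Lemma Ptop_surj j y : exists x, Ptop j x = y.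
Proof.
have [|x xE] := @Pincl_ex j (e j); first by rewrite e_mul eqxx.
exists (y *: x); rewrite linearZ /= comp_lfunE xE eps_e eqxx.
by rewrite /GRing.scale /= mulr1.
Qed.

Lemma Ptop_eq0 j (x : Pmod j) : Ptop j x = 0 -> (Pincl j x : A) \in J.
Proof.
rewrite comp_lfunE => x0; have := radv_el j (Pincl j x : A).
by rewrite x0 scale0r subr0 Pincl_mul.
Qed.

(** An endomorphism of e_j A is left multiplication by the image [z] of e_j, here a radical and
    hence nilpotent element. This supplies [p_local] for the top of [Pmod j]. *)
Lemma Ptop_local j (r : 'Hom(Pmod j, Pmod j)) : rmod_hom r ->
  (forall x, Ptop j (r x) = 0) -> exists m, forall x, iter m r x = 0.
Proof.
move=> rH rJ.
have [|u uE] := @Pincl_ex j (e j); first by rewrite e_mul eqxx.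
pose z : A := Pincl j (r u).
have rE x : Pincl j (r x) = z * (Pincl j x : A).
  have {1}-> : x = ract u (Pincl j x : A).
    apply: Pincl_inj; rewrite Pincl_hom uE /=; exact: esym (Pincl_mul x).
  by rewrite rH Pincl_hom.
have [m zm] := radv_nilp (Ptop_eq0 (rJ u)).
exists m => x; apply: Pincl_inj; rewrite linear0.
suff -> : Pincl j (iter m r x) = z ^+ m * (Pincl j x : A) by rewrite zm mul0r.
elim: m {zm} => [|m IH]; first by rewrite mul1r.
by rewrite iterS rE IH exprS mulrA.
Qed.

(* D(A), the dual of the left regular module, and its summands D(A e_i) below. *)
Definition D_act (f : 'Hom(A, K^o)) (a : A) : 'Hom(A, K^o) := (f \o amull a)%VF.

Lemma D_actE f a b : D_act f a b = f (a * b).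
Proof. by rewrite comp_lfunE lfunE. Qed.

Lemma D_linl a : linear (D_act^~ a).
Proof. by move=> c f g; rewrite /D_act comp_lfunDl comp_lfunZl. Qed.

Lemma D_linr f : linear (D_act f).
Proof.
move=> c a b; apply/lfunP => x; rewrite add_lfunE scale_lfunE !D_actE.
by rewrite mulrDl -scalerAl linearP.
Qed.

Lemma D_act1 f : D_act f 1 = f.
Proof. by apply/lfunP => x; rewrite D_actE mul1r. Qed.

Lemma D_actM f a b : D_act f (a * b) = D_act (D_act f a) b.
Proof. by apply/lfunP => x; rewrite !D_actE mulrA. Qed.

Definition Dmod : rmodule A := RModule D_linl D_linr D_act1 D_actM.

Definition D_hom_fun X (l : 'Hom(X, K^o)) (x : X) : Dmod := (l \o lfun_of (@ract_linearr _ _ X x))%VF.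

Lemma D_hom_lin X (l : 'Hom(X, K^o)) : linear (D_hom_fun l).
Proof.
move=> c x y; apply/lfunP => a; rewrite add_lfunE scale_lfunE !comp_lfunE !lfun_ofE.
by rewrite ractD ractZ linearP.
Qed.

Definition D_hom X (l : 'Hom(X, K^o)) : 'Hom(X, Dmod) := lfun_of (D_hom_lin l).

Lemma D_homE X (l : 'Hom(X, K^o)) x a : (D_hom l x : 'Hom(A, K^o)) a = l (ract x a).
Proof. by rewrite lfun_ofE comp_lfunE lfun_ofE. Qed.

Lemma D_hom_hom X (l : 'Hom(X, K^o)) : rmod_hom (D_hom l).
Proof.
move=> x a; apply/lfunP => b; rewrite D_homE.
by rewrite [RHS]D_actE D_homE ractM.
Qed.

(** Hom_A(X, DA) is the linear dual of [X], by evaluation at 1 with inverse [D_hom], and linear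
    functionals extend along injections. *)
Lemma Dmod_injective : injective_rmodule Dmod.
Proof.
apply: injectiveP => X Y g f gH fH gI.
have evL : linear (fun h : Dmod => (h : 'Hom(A, K^o)) 1).
  by move=> c h h'; rewrite add_lfunE scale_lfunE.
pose l : 'Hom(X, K^o) := (lfun_of evL \o f)%VF.
exists (D_hom (l \o g^-1)%VF); first exact: D_hom_hom.
move=> x; apply/lfunP => a; rewrite D_homE !comp_lfunE -gH.
rewrite lker0_lfunK; last by apply/eqP/lfun_injP.
by rewrite lfun_ofE fH [LHS]D_actE mulr1.
Qed.

(** D(A e_i) inside D(A), as the functionals unchanged by right multiplication by e_i in the
    argument; it is the injective hull of the i-th simple module. *)
Definition Iv i : {vspace Dmod} := limg (lfun_of (precomp_lin (amulr (e i)))).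

Lemma mem_Iv i (f : Dmod) :
  reflect (forall b, (f : 'Hom(A, K^o)) (b * e i) = f b) (f \in Iv i).
Proof.
apply: (iffP memv_imgP) => [[h _ ->] b|fE].
  by rewrite lfun_ofE !comp_lfunE !lfunE /= -mulrA e_mul eqxx.
exists f; rewrite ?memvf // lfun_ofE; apply/lfunP => b.
by rewrite comp_lfunE lfunE /= fE.
Qed.

Lemma Iv_submodule i : submodule (Iv i).
Proof.
move=> f a /mem_Iv fE; apply/mem_Iv => b.
by rewrite !D_actE mulrA fE.
Qed.

Definition Imod i := subrmod (@Iv_submodule i).
Definition Iincl i : 'Hom(Imod i, Dmod) := sub_incl (@Iv_submodule i).

Lemma Iincl_hom i : rmod_hom (Iincl i). Proof. exact: sub_incl_hom. Qed.

Lemma Iincl_inj i : injective (Iincl i).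
Proof. by apply/lker0P/eqP/lfun_injP/sub_incl_inj. Qed.

Lemma Iincl_er i (f : Imod i) b : (Iincl i f : 'Hom(A, K^o)) (b * e i) = (Iincl i f : 'Hom(A, K^o)) b.
Proof. by apply/mem_Iv; apply: sub_incl_mem. Qed.

Lemma Imod_injective i : injective_rmodule (Imod i).
Proof.
pose p : 'Hom(Dmod, Dmod) := lfun_of (precomp_lin (amulr (e i))).
have pE (f : Dmod) b : (p f : 'Hom(A, K^o)) b = (f : 'Hom(A, K^o)) (b * e i).
  by rewrite lfun_ofE comp_lfunE lfunE.
have pH : rmod_hom p.
  by move=> f a; apply/lfunP => b; rewrite [RHS]D_actE !pE [LHS]D_actE mulrA.
have [f|q qH qE] := hom_lift (@Iincl_hom i) pH (@sub_incl_inj _ _ _ _ (@Iv_submodule i)).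
  by apply: sub_incl_ex; rewrite memv_img ?memvf.
apply: (injective_retract (@Iincl_hom i) qH) => [x|]; last exact: Dmod_injective.
apply: Iincl_inj; rewrite qE; apply/lfunP => b.
by rewrite pE Iincl_er.
Qed.

End Basic.

(** * Dimension vectors and minimal generators *)

Section Covers.
Variables (K : fieldType) (A : falgType K) (n : nat).
Variables (e : 'I_n -> A) (eps : 'I_n -> 'Hom(A, K^o)).
Hypothesis H : basic e eps.
Local Notation J := (radv eps).
Local Notation P := (Pmod H).
Local Notation I := (Imod H).
Implicit Types M N X Y Z B Q : rmodule A.

(** The multiplicity of the k-th simple module in [M]; these vectors stand for classes in the
    Grothendieck group. *)
Definition dimvec M (k : 'I_n) : nat := \dim (limg (ract_lfun M (e k))).

Lemma mem_ract_lfun M k (m : M) : (m \in limg (ract_lfun M (e k))) = (ract m (e k) == m).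
Proof.
apply/memv_imgP/eqP => [[u _ ->]|mE].
  by rewrite ract_lfunE -ractM (basic_mul H) eqxx.
by exists m; rewrite ?memvf ?ract_lfunE ?mE.
Qed.

Lemma dimvec_ses X Y Z (f : 'Hom(X, Y)) (g : 'Hom(Y, Z)) k :
  ses f g -> dimvec Y k = (dimvec X k + dimvec Z k)%N.
Proof.
move=> S; rewrite /dimvec -(limg_ker_dim g (limg (ract_lfun Y (e k)))).
have -> : (limg (ract_lfun Y (e k)) :&: lker g)%VS = (f @: limg (ract_lfun X (e k)))%VS.
  apply/vspaceP => y; apply/memv_capP/memv_imgP => [[]|[x xk ->]].
    rewrite mem_ract_lfun memv_ker => /eqP yk /eqP gy; have [x xE] := ses_ex S gy.
    exists (ract x (e k)); last by rewrite (ses_homl S) xE yk.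
    by rewrite mem_ract_lfun -ractM (basic_mul H) eqxx.
  move: xk; rewrite !mem_ract_lfun => /eqP xk.
  by rewrite -(ses_homl S) xk memv_ker (ses_comp S).
rewrite limg_dim_eq; last first.
  by rewrite (_ : lker f = 0%VS) ?capv0 //; apply/lfun_injP/(ses_inj S).
congr (_ + \dim _)%N; apply/vspaceP => z; apply/memv_imgP/idP => [[y yk ->]|].
  by move: yk; rewrite !mem_ract_lfun -(ses_homr S) => /eqP->.
rewrite mem_ract_lfun => /eqP zk; have [y yE] := ses_surj S z.
exists (ract y (e k)); last by rewrite (ses_homr S) yE zk.
by rewrite mem_ract_lfun -ractM (basic_mul H) eqxx.
Qed.

Lemma dimvec_iso X Y (f : 'Hom(X, Y)) k : rmod_hom f ->
  (forall x, f x = 0 -> x = 0) -> (forall y, exists x, f x = y) -> dimvec X k = dimvec Y k.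
Proof.
move=> fH fI fS; rewrite /dimvec -(limg_dim_eq (f := f)); last first.
  by rewrite (_ : lker f = 0%VS) ?capv0 //; apply/lfun_injP.
congr (\dim _); apply/vspaceP => y; apply/memv_imgP/idP => [[x xk ->]|].
  by move: xk; rewrite !mem_ract_lfun -fH => /eqP->.
rewrite mem_ract_lfun => /eqP yk; have [x xE] := fS y.
by exists (ract x (e k)); rewrite ?fH ?xE // mem_ract_lfun -ractM (basic_mul H) eqxx.
Qed.

Lemma dimvec_dsum (T : finType) (M : T -> rmodule A) N
    (i : forall a, 'Hom(M a, N)) (p : forall a, 'Hom(N, M a)) k :
  dsum i p -> dimvec N k = (\sum_a dimvec (M a) k)%N.
Proof.
move=> S.
have iI a x : i a x = 0 -> x = 0.
  by move=> x0; rewrite -(dsum_pi S x) x0 linear0.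
have E : limg (ract_lfun N (e k)) = (\sum_a (i a @: limg (ract_lfun (M a) (e k))))%VS.
  apply/vspaceP => y; apply/idP/memv_sumP => [|[us usP ->]].
    rewrite mem_ract_lfun => /eqP yk; exists (fun a => i a (p a y)); last by rewrite (dsum_sum S).
    by move=> a _; rewrite memv_img // mem_ract_lfun -(dsum_homp S) yk.
  apply: memv_suml => a _; have /memv_imgP[x xk ->] := usP a isT.
  by move: xk; rewrite !mem_ract_lfun -(dsum_homi S) => /eqP->.
have /directvP Ed : directv (\sum_a (i a @: limg (ract_lfun (M a) (e k)))).
  apply/directv_sum_independent => us usP us0 b _.
  have /memv_imgP[x _ xE] := usP b isT.
  have := congr1 (p b) us0; rewrite linear_sum linear0 (bigD1 b) //= xE (dsum_pi S).
  rewrite big1 ?addr0 => [->|a ab]; first by rewrite linear0.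
  by have /memv_imgP[y _ ->] := usP a isT; rewrite (dsum_pi0 S).
rewrite /dimvec E Ed /=; apply: eq_bigr => a _.
rewrite limg_dim_eq // (_ : lker (i a) = 0%VS) ?capv0 //.
exact/lfun_injP/iI.
Qed.

Lemma dimvec_P j k : dimvec (P j) k = \dim (<[e j]> * {:A} * <[e k]>)%VS.
Proof.
have <- : Pv e j = (<[e j]> * {:A})%VS.
  apply/eqP; rewrite eqEsubv; apply/andP; split; last first.
    apply/prodvP => u v /vlineP[c ->] _.
    by rewrite (mem_Pv H) -scalerAl -scalerAr mulrA (basic_mul H) eqxx.
  apply/subvP => x; rewrite (mem_Pv H) => /eqP<-.
  by rewrite memv_mul ?memv_line ?memvf.
rewrite -limg_amulr /dimvec.
rewrite -(limg_dim_eq (f := Pincl H j)); last first.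
  by rewrite (_ : lker _ = 0%VS) ?capv0 //; apply/lfun_injP/sub_incl_inj.
rewrite -limg_comp (_ : (_ \o _)%VF = (amulr (e k) \o Pincl H j)%VF).
  by rewrite limg_comp limg_sub_incl.
by apply/lfunP => x; rewrite !comp_lfunE ract_lfunE Pincl_hom [RHS]lfunE.
Qed.

(** D(A e_i) e_k is dual to e_k A e_i. With [dimvec_P], the columns of the Cartan matrix are the
    vectors of the projectives and its rows those of the injectives. *)
Lemma dimvec_I i k : dimvec (I i) k = \dim (<[e k]> * {:A} * <[e i]>)%VS.
Proof.
rewrite -limg_amulr.
have <- : Pv e k = (<[e k]> * {:A})%VS.
  apply/eqP; rewrite eqEsubv; apply/andP; split; last first.
    apply/prodvP => u v /vlineP[c ->] _.
    by rewrite (mem_Pv H) -scalerAl -scalerAr mulrA (basic_mul H) eqxx.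
  apply/subvP => x; rewrite (mem_Pv H) => /eqP<-.
  by rewrite memv_mul ?memv_line ?memvf.
rewrite /Pv -limg_comp -dim_limg_precomp /dimvec.
rewrite -(limg_dim_eq (f := Iincl H i)); last first.
  by rewrite (_ : lker _ = 0%VS) ?capv0 //; apply/lfun_injP/sub_incl_inj.
rewrite -limg_comp.
rewrite (_ : (_ \o _)%VF = (lfun_of (precomp_lin (amull (e k))) \o Iincl H i)%VF); last first.
  by apply/lfunP => x; rewrite !comp_lfunE ract_lfunE Iincl_hom lfun_ofE.
rewrite limg_comp limg_sub_incl -limg_comp; congr (\dim (limg _)).
by apply/lfunP => f; rewrite comp_lfunE !lfun_ofE comp_lfunA.
Qed.

Definition generates M r (j : 'I_r -> 'I_n) (m : 'I_r -> M) :=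
  (forall a, ract (m a) (e (j a)) = m a) /\
  forall x, exists y : 'I_r -> A, x = \sum_a ract (m a) (y a).

Lemma generators_exist M : exists r (j : 'I_r -> 'I_n) (m : 'I_r -> M), generates j m.
Proof.
pose T : finType := ('I_(\dim {:M}) * 'I_n)%type.
exists #|T|, (fun a => (enum_val a : T).2),
  (fun a => ract ((vbasis {:M})`_(enum_val a : T).1) (e (enum_val a : T).2)).
split=> [a|x]; first by rewrite -ractM (basic_mul H) eqxx.
exists (fun a => coord (vbasis {:M}) (enum_val a : T).1 x *: 1).
pose F (t : T) := ract (ract ((vbasis {:M})`_t.1) (e t.2)) (coord (vbasis {:M}) t.1 x *: 1).
rewrite -[RHS](reindex _ (onW_bij _ (enum_val_bij T)) (P := xpredT) (F := F)) /=.
rewrite -(pair_bigA _ (fun s i => F (s, i))) /=.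
rewrite {1}(coord_vbasis (memvf x)); apply: eq_bigr => s _.
by rewrite /F /= -ract_suml -ract_sumr (basic_sum H) ract1 ractZr ract1.
Qed.

(** Take a generating family of least size: a relation with a coefficient outside the radical would
    allow that generator to be eliminated. *)
Lemma minimal_generators M : exists r (j : 'I_r -> 'I_n) (m : 'I_r -> M),
  generates j m /\ forall a x (y : 'I_r -> A), e (j a) * x = x ->
    ract (m a) x = \sum_(b | b != a) ract (m b) (y b) -> x \in J.
Proof.
have [N [j [m G]] Nmin] := exists_min (generators_exist M).
exists N, j, m; split=> // a x y xE mx; apply/negPn/negP => xJ.
set c := eps (j a) x.
have xc : x - c *: e (j a) \in J by rewrite -{1}xE (radv_el H).
have c0 : c != 0 by apply: contra xJ => /eqP c0; move: xc; rewrite c0 scale0r subr0.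
(* Modulo the radical [x] is c e_(j a), so [z] is radical and 1 - z has a right inverse; and m_a (1
   - z) = c^-1 m_a x is a combination of the other generators. *)
pose z := e (j a) - c^-1 *: x.
have zJ : z \in J.
  rewrite /z -opprB memvN -[e (j a)]scale1r -(mulVf c0) -scalerA -scalerBr.
  exact: memvZ.
have [w zw] := radv_inv H zJ.
have [mE mG] := G.
have [v maE] : exists v : 'I_N -> A, m a = \sum_(b | b != a) ract (m b) (v b).
  exists (fun b => c^-1 *: y b * w).
  rewrite -[LHS]ract1 -zw ractM ractDr ractNr /z ractDr ractNr mE ract1 ractZr mx.
  rewrite opprD addrA subrr add0r opprK ractZ ract_suml scaler_sumr.
  by apply: eq_bigr => b _; rewrite -scalerAl ractZr ractM.
clear x y xE mx xJ c xc c0 z zJ w zw.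
case: N j m G Nmin a v mE mG maE => [|N] j m G Nmin a v mE mG maE; first by case: a {v maE}.
suff /Nmin : exists (j' : 'I_N -> 'I_n) (m' : 'I_N -> M), generates j' m' by rewrite ltnn.
exists (j \o lift a), (m \o lift a); split=> [b|x].
  exact: mE.
have [u ->] := mG x.
exists (fun b => v (lift a b) * u a + u (lift a b)).
rewrite (bigD1_ord a) //= {1}maE big_mkcond (bigD1_ord a) //= eqxx add0r ract_suml -big_split /=.
apply: eq_bigr => b _; rewrite eq_sym neq_lift ractDr; congr (_ + _).
by rewrite -ractM.
Qed.

End Covers.

(** * Projective covers and injective hulls *)

Section Envelopes.
Variables (K : fieldType) (A : falgType K) (n : nat).
Variables (e : 'I_n -> A) (eps : 'I_n -> 'Hom(A, K^o)).
Hypothesis H : basic e eps.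
Local Notation J := (radv eps).
Local Notation P := (Pmod H).
Local Notation I := (Imod H).
Implicit Types M N X Y Z B Q : rmodule A.

Lemma dsum_pr_in (T : finType) (M : T -> rmodule A) N
    (i : forall a, 'Hom(M a, N)) (p : forall a, 'Hom(N, M a)) (x : forall a, M a) b :
  dsum i p -> p b (\sum_a i a (x a)) = x b.
Proof.
move=> S; rewrite linear_sum (bigD1 b) //= (dsum_pi S) big1 ?addr0 // => a ab.
by rewrite (dsum_pi0 S).
Qed.

(** Minimal generators give the projective cover: an element of the kernel is a relation, so its
    coordinates are radical. *)
Lemma cover M : exists r (j : 'I_r -> 'I_n) Q (i : forall a, 'Hom(P (j a), Q))
    (p : forall a, 'Hom(Q, P (j a))) (phi : 'Hom(Q, M)),
  [/\ dsum i p, rmod_hom phi, forall y, exists x, phi x = y &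
      forall x, phi x = 0 -> forall a, (Pincl H (j a) (p a x) : A) \in J].
Proof.
have [r [j [m [[mE mG] mmin]]]] := minimal_generators H M.
have [i [p S]] := @dsum_exists _ _ _ (regular_rmodule A) (fun a : 'I_r => Pv e (j a))
  (fun a => @Pv_submodule _ _ _ _ _ H (j a)).
exists r, j, (dsum_mod (fun a => @Pv_submodule _ _ _ _ _ H (j a))), i, p.
pose mu (x : M) : 'Hom(regular_rmodule A, M) := lfun_of (@ract_linearr _ _ M x).
have muH x : rmod_hom (mu x) by move=> y a; rewrite !lfun_ofE ractM.
exists (\sum_a ((mu (m a) \o Pincl H (j a)) \o p a))%VF.
have phiE x : (\sum_a ((mu (m a) \o Pincl H (j a)) \o p a))%VF x =
    \sum_a ract (m a) (Pincl H (j a) (p a x) : A).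
  by rewrite sum_lfunE; apply: eq_bigr => a _; rewrite !comp_lfunE lfun_ofE.
split=> //.
- apply: hom_sum => a; apply: hom_comp; last exact: (dsum_homp S).
  by apply: hom_comp; [exact: muH | exact: Pincl_hom].
- move=> y; have [u ->] := mG y.
  have /fin_all_exists[x xE] a : exists x, Pincl H (j a) x = e (j a) * u a.
    by apply: Pincl_ex; rewrite mulrA (basic_mul H) eqxx.
  exists (\sum_a i a (x a)); rewrite phiE; apply: eq_bigr => a _.
  by rewrite (dsum_pr_in x a S) xE ractM mE.
- move=> x; rewrite phiE => x0 a.
  apply: (mmin a _ (fun b => - (Pincl H (j b) (p b x) : A))); first exact: Pincl_mul.
  apply/eqP; rewrite -subr_eq0 -sumrN; apply/eqP; rewrite -[RHS]x0 [RHS](bigD1 a) //=.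
  by congr (_ + _); apply: eq_bigr => b _; rewrite ractNr opprK.
Qed.

(** The kernel of the cover lies in the radical of [Q], so the projection of [Q] to the top of a
    summand descends to [M]. *)
Lemma cover_top M r (j : 'I_r -> 'I_n) Q (i : forall a, 'Hom(P (j a), Q))
    (p : forall a, 'Hom(Q, P (j a))) (phi : 'Hom(Q, M)) a :
  dsum i p -> rmod_hom phi -> (forall y, exists x, phi x = y) ->
  (forall x, phi x = 0 -> forall a, (Pincl H (j a) (p a x) : A) \in J) ->
  exists2 q : 'Hom(M, Smod H (j a)), rmod_hom q & forall y, exists x, q x = y.
Proof.
move=> S phiH phiS phiK.
have tH : rmod_hom (Ptop H (j a) \o p a)%VF.
  by apply: hom_comp; [exact: Ptop_hom | exact: (dsum_homp S)].
have [x x0|q qH qE] := hom_factor phiH tH phiS.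
  by rewrite !comp_lfunE; have /mem_radvP -> := phiK x x0 a.
exists q => // y; have [x xE] := Ptop_surj y.
by exists (phi (i a x)); rewrite qE comp_lfunE (dsum_pi S).
Qed.

(** For a section [s], r' = 1 - s phi projects onto the kernel. Writing a kernel element with
    radical coefficients and applying r' gains a power of the radical each time, so the kernel
    vanishes by nilpotency. *)
Lemma cover_projective M r (j : 'I_r -> 'I_n) Q (i : forall a, 'Hom(P (j a), Q))
    (p : forall a, 'Hom(Q, P (j a))) (phi : 'Hom(Q, M)) :
  dsum i p -> rmod_hom phi -> (forall y, exists x, phi x = y) ->
  (forall x, phi x = 0 -> forall a, (Pincl H (j a) (p a x) : A) \in J) ->
  projective M -> forall x, phi x = 0 -> x = 0.
Proof.
move=> S phiH phiS phiK PM x x0.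
have [s sH sE] := proj_lift PM phiH (hom_id M) phiS.
pose r' := (\1 - (s \o phi))%VF.
have r'H : rmod_hom r' by apply: hom_sub; [exact: hom_id | exact: hom_comp].
have r'E y : phi (r' y) = 0.
  by rewrite sub_lfunE id_lfunE comp_lfunE linearB /= sE id_lfunE subrr.
have r'x y : phi y = 0 -> r' y = y.
  by move=> y0; rewrite sub_lfunE id_lfunE comp_lfunE y0 linear0 subr0.
have /fin_all_exists[u uE] a : exists u, Pincl H (j a) u = e (j a).
  by apply: Pincl_ex; rewrite (basic_mul H) eqxx.
have expand y : y = \sum_a ract (i a (u a)) (Pincl H (j a) (p a y) : A).
  rewrite -[LHS](dsum_sum S); apply: eq_bigr => a _.
  rewrite -(dsum_homi S); congr (i a _); apply: Pincl_inj.
  by rewrite Pincl_hom uE [RHS]Pincl_mul.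
have [m Jm] := basic_nil H.
suff Km y : phi y = 0 -> forall a, (Pincl H (j a) (p a y) : A) \in (J ^+ m.+1)%VS.
  apply: (dsum_ext S) => a; apply: (@Pincl_inj _ _ _ _ _ H).
  by have := Km x x0 a; rewrite Jm memv0 => /eqP->; rewrite !linear0.
elim: m {Jm} y => [|m IH] y y0 a; first by rewrite expv1; apply: phiK.
rewrite -(r'x y y0) {1}(expand y) !linear_sum /= memv_suml // => b _.
rewrite r'H (dsum_homp S) Pincl_hom /= expvSr memv_mul //; last exact: phiK.
by apply: IH; apply: r'E.
Qed.

(** Dual of [generates]: such functionals are the components of an embedding of [B] into a sum of
    modules D(A e_i). *)
Definition separates B r (c : 'I_r -> 'I_n) (l : 'I_r -> 'Hom(B, K^o)) :=
  (forall a x, l a (ract x (e (c a))) = l a x) /\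
  forall x, (forall a y, l a (ract x y) = 0) -> x = 0.

Lemma separating_exist B : exists r (c : 'I_r -> 'I_n) (l : 'I_r -> 'Hom(B, K^o)),
  separates c l.
Proof.
pose T : finType := ('I_(\dim {:B}) * 'I_n)%type.
have lL (t : T) : linear (fun x : B => coord (vbasis {:B}) t.1 (ract x (e t.2)) : K^o).
  by move=> k x y; rewrite ractD ractZ linearP.
exists #|T|, (fun a => (enum_val a : T).2), (fun a => lfun_of (lL (enum_val a))).
split=> [a x|x x0]; first by rewrite !lfun_ofE -ractM (basic_mul H) eqxx.
rewrite -[x]ract1 -(basic_sum H) ract_sumr big1 // => i _.
rewrite (coord_vbasis (memvf (ract x (e i)))) big1 // => s _.
have := x0 (enum_rank (s, i)) 1.
by rewrite lfun_ofE enum_rankK /= ract1 => ->; rewrite scale0r.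
Qed.

Lemma minimal_separating B : exists r (c : 'I_r -> 'I_n) (l : 'I_r -> 'Hom(B, K^o)),
  separates c l /\ forall a, exists s : B,
    [/\ l a s != 0, forall b y, b != a -> l b (ract s y) = 0 &
        forall y, l a (ract s y) = l a s * eps (c a) y].
Proof.
have [r [c [l G]] rmin] := exists_min (separating_exist B).
exists r, c, l; split=> // a; have [lE lS] := G.
(* Dropping [l a] from a family of least size leaves a nonzero [b] on whose submodule the other
   functionals vanish; a simple submodule of b A then provides [s]. *)
have [b [b0 bl]] : exists b : B, b != 0 /\ forall t y, t != a -> l t (ract b y) = 0.
  apply: boolp.contrapT => nob.
  case: r c l G rmin a lE lS nob => [|r] c l G rmin a lE lS nob; first by case: a {nob}.
  suff /rmin : exists (c' : 'I_r -> 'I_n) (l' : 'I_r -> 'Hom(B, K^o)), separates c' l'.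
    by rewrite ltnn.
  exists (c \o lift a), (l \o lift a); split=> [t x|x x0]; first exact: lE.
  apply/eqP/negPn/negP => xn0; apply: nob; exists x; split=> // t y ta.
  have [t' ->] : exists t', t = lift a t'.
    by case: (unliftP a t) ta => [t' -> _|->]; [exists t' | rewrite eqxx].
  exact: x0.
have hU : @submodule _ _ B 0%VS by move=> x y; rewrite !memv0 => /eqP->; rewrite ract0.
rewrite -memv0 in b0.
have [i [d [s0 si sJ]]] := socle H hU b0.
set s := ract b d in s0 si sJ.
have sl t y : t != a -> l t (ract s y) = 0 by move=> ta; rewrite -ractM bl.
have sy y : ract s y = eps i y *: s.
  have := sJ _ (radv_el H i y); rewrite memv0 => /eqP.
  rewrite ractDr ractNr ractM si ractZr si => /eqP; rewrite subr_eq0 => /eqP->.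
  by [].
have ls : l a s != 0.
  apply: contra s0 => /eqP ls; rewrite memv0; apply/eqP/lS => t y.
  have [->|ta] := eqVneq t a; last exact: sl.
  by rewrite sy linearZ /= ls scaler0.
have ic : i = c a.
  apply/eqP; apply: contraR ls => ia; rewrite -lE sy (basic_eps_e H) (negPf ia).
  by rewrite scale0r linear0.
by exists s; split=> // y; rewrite sy linearZ /= ic /GRing.scale /= mulrC.
Qed.

(** A minimal separating family embeds [B] in a sum of modules [I]. Every nonzero submodule of the
    sum contains an [x] spanning a simple module, and [x] is the image of a combination of the
    elements [s a]. *)
Lemma hull B : exists r (c : 'I_r -> 'I_n) Q (i : forall a, 'Hom(I (c a), Q))
    (p : forall a, 'Hom(Q, I (c a))) (psi : 'Hom(B, Q)),
  [/\ dsum i p, rmod_hom psi, forall x, psi x = 0 -> x = 0 & essential (limg psi)].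
Proof.
have [r [c [l [[lE lS] lmin]]]] := minimal_separating B.
have [i [p S]] := @dsum_exists _ _ _ (Dmod A) (fun a : 'I_r => Iv e (c a))
  (fun a => @Iv_submodule _ _ _ _ _ H (c a)).
exists r, c, (dsum_mod (fun a => @Iv_submodule _ _ _ _ _ H (c a))), i, p.
have /fin_all_exists2[q qH qE] a : exists2 q : 'Hom(B, I (c a)), rmod_hom q &
    forall x, Iincl H (c a) (q x) = D_hom (l a) x.
  apply: (hom_lift (@Iincl_hom _ _ _ _ _ H (c a)) (@D_hom_hom _ _ _ (l a))).
    exact: sub_incl_inj.
  move=> x; apply: sub_incl_ex; apply/(mem_Iv H) => b.
  by rewrite !D_homE ractM lE.
exists (\sum_a (i a \o q a))%VF.
have psiE x : (\sum_a (i a \o q a))%VF x = \sum_a i a (q a x).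
  by rewrite sum_lfunE; apply: eq_bigr => a _; rewrite comp_lfunE.
split=> //.
- by apply: hom_sum => a; apply: hom_comp (qH a); apply: (dsum_homi S).
- move=> x x0; apply: lS => a y; rewrite -D_homE -qE.
  have -> : q a x = 0 by rewrite -(dsum_pr_in (fun a => q a x) a S) -psiE x0 linear0.
  by rewrite linear0 zero_lfunE.
set psi := (\sum_a _)%VF in psiE *.
move=> W hW W0 WI.
have [y yW y0] : exists2 y, y \in W & y \notin 0%VS.
  apply/subvPn; apply/negP; rewrite subv0 => /eqP; exact: W0.
have hU : submodule (0%VS : {vspace dsum_mod (fun a => @Iv_submodule _ _ _ _ _ H (c a))}).
  by move=> x z; rewrite !memv0 => /eqP->; rewrite ract0.
have [k [d [x0 xk xJ]]] := socle H hU y0.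
have xW : ract y d \in W by apply: hW.
set x := ract y d in x0 xk xJ xW.
have /fin_all_exists[s sP] a := lmin a.
pose f a : 'Hom(A, K^o) := Iincl H (c a) (p a x).
(* The radical kills [x], so each coordinate of [x] is a multiple of the character [eps (c a)], as
   is the image of [s a]. *)
have fE a b : f a b = f a (e (c a)) * eps (c a) b.
  rewrite -[LHS]Iincl_er -[b * e (c a)](subrK (eps (c a) b *: e (c a))).
  rewrite linearD /f /=.
  have := xJ _ (radv_er H (c a) b); rewrite memv0 => /eqP x0'.
  have := Iincl_hom (p a x) (b * e (c a) - eps (c a) b *: e (c a)).
  rewrite -(dsum_homp S) x0' !linear0 => /(congr1 (fun h : 'Hom(A, K^o) => h 1)).
  rewrite zero_lfunE [RHS]D_actE mulr1 => <-.
  by rewrite add0r linearZ /GRing.scale /= mulrC.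
have xE : x = psi (\sum_a (f a (e (c a)) / l a (s a)) *: s a).
  rewrite linear_sum; apply: (dsum_ext S) => a.
  have [ls sl se] := sP a.
  rewrite linear_sum (bigD1 a) //= big1 ?addr0 => [|b ba]; last first.
    rewrite !linearZ /= psiE (dsum_pr_in (fun a => q a (s b)) a S).
    have -> : q a (s b) = 0; last by rewrite scaler0.
    apply: (@Iincl_inj _ _ _ _ _ H); rewrite linear0 qE; apply/lfunP => z.
    have [_ slb _] := sP b.
    by rewrite D_homE zero_lfunE slb // eq_sym.
  rewrite !linearZ /= psiE (dsum_pr_in (fun t => q t (s a)) a S).
  apply: (@Iincl_inj _ _ _ _ _ H); rewrite linearZ /= qE; apply/lfunP => z.
  rewrite scale_lfunE D_homE se -/(f a) [LHS]fE /GRing.scale /=.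
  by rewrite mulrA divfK.
have : x \in (W :&: limg psi)%VS by rewrite memv_cap xW xE memv_img ?memvf.
by rewrite WI (negPf x0).
Qed.

End Envelopes.

(** * Quotient modules *)

Section Quotient.
Variables (K : fieldType) (A : falgType K).
Variables (M : rmodule A) (U : {vspace M}) (hU : submodule U).

(** M / U is carried by a linear complement of [U], the quotient map being the projection along
    [U]. *)
Let g : 'Hom(M, subvs_of (U^C)%VS) := (linfun (vsproj (U^C)%VS) \o daddv_pi (U^C)%VS U)%VF.

Let g_eq0 m : (g m == 0) = (m \in U).
Proof.
have d1 : (U^C :&: U = 0)%VS by rewrite capvC capv_compl.
have d2 : (U :&: U^C = 0)%VS by rewrite capv_compl.
have mf : m \in (U^C + U)%VS by rewrite addvC addv_complf memvf.
rewrite comp_lfunE lfunE /=; apply/eqP/idP => [/(congr1 vsval)|mU].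
  rewrite vsprojK ?memv_pi // linear0 => m0.
  by rewrite -(daddv_pi_add d1 mf) m0 add0r memv_pi.
have := daddv_pi_add d1 mf; rewrite (daddv_pi_id d2 mU) => /eqP.
by rewrite -subr_eq0 addrK => /eqP->; rewrite linear0.
Qed.

Let g_surj v : exists m, g m = v.
Proof.
exists (vsval v); apply: subvs_inj.
rewrite comp_lfunE lfunE /= vsprojK ?memv_pi // daddv_pi_id ?subvsP //.
by rewrite capvC capv_compl.
Qed.

Let gK v : g (g^-1%VF v) = v.
Proof. by rewrite limg_lfunVK //; have [m <-] := g_surj v; rewrite memv_img ?memvf. Qed.

Definition quot_act (v : subvs_of (U^C)%VS) (a : A) := g (ract (g^-1%VF v) a).

Let quot_actE m a : quot_act (g m) a = g (ract m a).
Proof.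
apply/eqP; rewrite -subr_eq0 -linearB g_eq0 -ractN -ractD; apply: hU.
by rewrite -g_eq0 linearB /= gK subrr.
Qed.

Lemma quot_linl a : linear (quot_act^~ a).
Proof.
move=> c x y; have [m <-] := g_surj x; have [m' <-] := g_surj y.
by rewrite -linearP !quot_actE ractD ractZ linearP.
Qed.

Lemma quot_linr x : linear (quot_act x).
Proof. by move=> c a b; rewrite /quot_act ractDr ractZr linearP. Qed.

Lemma quot_act1 x : quot_act x 1 = x.
Proof. by have [m <-] := g_surj x; rewrite quot_actE ract1. Qed.

Lemma quot_actM x a b : quot_act x (a * b) = quot_act (quot_act x a) b.
Proof. by have [m <-] := g_surj x; rewrite !quot_actE ractM. Qed.

Definition quotmod : rmodule A := RModule quot_linl quot_linr quot_act1 quot_actM.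

Lemma quot_exists : exists g' : 'Hom(M, quotmod),
  [/\ rmod_hom g', forall y, exists x, g' x = y & forall m, (g' m == 0) = (m \in U)].
Proof.
by exists g; split; [move=> m a; rewrite -quot_actE | exact: g_surj | exact: g_eq0].
Qed.

End Quotient.

Section Endo.
Variables (K : fieldType) (V : vectType K) (f : 'End(V)).

Lemma endo_inj_surj : (forall x, f x = 0 -> x = 0) -> forall y, exists x, f x = y.
Proof.
move=> /lfun_injP fI; apply/lfun_surjP/eqP.
have fI' : (fullv :&: lker f = 0)%VS by rewrite [lker f]fI capv0.
by rewrite eqEdim subvf (limg_dim_eq fI') leqnn.
Qed.

Lemma endo_surj_inj : (forall y, exists x, f x = y) -> forall x, f x = 0 -> x = 0.
Proof.
move=> /lfun_surjP fS; apply/lfun_injP/eqP; rewrite -dimv_eq0.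
have := limg_ker_dim f fullv; rewrite capfv fS => /eqP.
by rewrite -[X in _ == X]add0n eqn_add2r.
Qed.

End Endo.

(** * Minimal injective coresolutions of the indecomposable projectives *)

Section Resolutions.
Variables (K : fieldType) (A : falgType K) (n : nat).
Variables (e : 'I_n -> A) (eps : 'I_n -> 'Hom(A, K^o)).
Hypothesis H : basic e eps.
Local Notation P := (Pmod H).
Local Notation I := (Imod H).
Local Notation S := (Smod H).
Local Notation R := (regular_rmodule A).
Local Notation dimv M := (dimvec e M).
Implicit Types M N X Y Z B Q : rmodule A.

Lemma dimvec_S j k : dimv (S j) k = (j == k).
Proof.
rewrite /dimvec; have rE (x : S j) : ract_lfun (S j) (e k) x = (j == k)%:R * (x : K).
  by rewrite ract_lfunE /= /S_act (basic_eps_e H) mulrC.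
case: eqVneq rE => [_|_] rE.
  rewrite (_ : limg _ = fullv) ?dimvf //; apply/lfun_surjP => y.
  by exists y; rewrite rE mul1r.
rewrite (_ : ract_lfun _ _ = 0) ?lim0g ?dimv0 //.
by apply/lfunP => x; rewrite rE mul0r zero_lfunE.
Qed.

Definition is_injsum (J : rmodule A) r (c : 'I_r -> 'I_n) :=
  exists (i : forall a, 'Hom(I (c a), J)) (p : forall a, 'Hom(J, I (c a))), dsum i p.

Lemma hull_step B : exists X : {J : rmodule A & {C : rmodule A & ('Hom(B, J) * 'Hom(J, C))%type}},
  [/\ ses (projT2 (projT2 X)).1 (projT2 (projT2 X)).2,
      essential (limg (projT2 (projT2 X)).1) &
      exists r (c : 'I_r -> 'I_n), is_injsum (projT1 X) c].
Proof.
have [r [c [Q [i [p [f [D fH fI fE]]]]]]] := hull H B.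
have [g [gH gS gK]] := quot_exists (limg_submodule fH).
exists (existT _ Q (existT _ (quotmod (limg_submodule fH)) (f, g))) => /=; split=> //.
  split=> //.
    by move=> x; apply/eqP; rewrite gK memv_img ?memvf.
  by move=> y /eqP; rewrite gK => /memv_imgP[x _ ->]; exists x.
by exists r, c, i, p.
Qed.

Section Coresolution.
Variable j : 'I_n.

Definition hull_data B := sval (boolp.cid (hull_step B)).

(* The minimal injective coresolution of P j: its terms are the coterm t, and cosyz t
   is the kernel of the map out of coterm t. *)
Fixpoint cosyz t : rmodule A := if t is t'.+1 then projT1 (projT2 (hull_data (cosyz t'))) else P j.
Definition coterm t : rmodule A := projT1 (hull_data (cosyz t)).
Definition coterm_in t : 'Hom(cosyz t, coterm t) := (projT2 (projT2 (hull_data (cosyz t)))).1.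
Definition coterm_out t : 'Hom(coterm t, cosyz t.+1) := (projT2 (projT2 (hull_data (cosyz t)))).2.

Lemma cosyz_ses t : ses (coterm_in t) (coterm_out t).
Proof. by case: (proj2_sig (boolp.cid (hull_step (cosyz t)))). Qed.

Lemma cosyz_essential t : essential (limg (coterm_in t)).
Proof. by case: (proj2_sig (boolp.cid (hull_step (cosyz t)))). Qed.

Lemma coterm_sum t : exists r (c : 'I_r -> 'I_n), is_injsum (coterm t) c.
Proof. by case: (proj2_sig (boolp.cid (hull_step (cosyz t)))). Qed.

Lemma coterm_injective t : injective_rmodule (coterm t).
Proof.
have [r [c [i [p D]]]] := coterm_sum t.
by apply: (dsum_injective D) => a; apply: Imod_injective.
Qed.

(** The image of a section meets the image of [coterm_in t] only in zero, so it vanishes by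
    essentiality. *)
Lemma cosyz_split_zero t (z : 'Hom(cosyz t.+1, coterm t)) : rmod_hom z ->
  (forall x, coterm_out t (z x) = x) -> forall x : cosyz t.+1, x = 0.
Proof.
move=> zH gz x.
suff z0 : limg z = 0%VS.
  by rewrite -(gz x) (_ : z x = 0) ?linear0 //; apply/eqP; rewrite -memv0 -z0 memv_img ?memvf.
apply: boolp.contrapT => z0; apply: (cosyz_essential (limg_submodule zH) z0).
apply/eqP; rewrite -subv0; apply/subvP => y /memv_capP[/memv_imgP[u _ ->] /memv_imgP[v _ zv]].
by rewrite memv0 -(gz u) zv (ses_comp (cosyz_ses t)) linear0.
Qed.

Section Compare.
Variables (E : nat -> rmodule A) (eta : 'Hom(R, E 0%N)) (d : forall t, 'Hom(E t, E t.+1)).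
Hypothesis CE : injective_coresolution eta d.
Hypothesis PE : forall t, pdim_bound t (E t).

Definition ecosyz t : rmodule A :=
  if t is t'.+1 then subrmod (lker_submodule (injres_hom CE (i := t'.+1))) else R.

Definition ecosyz_in t : 'Hom(ecosyz t, E t) :=
  match t with
  | 0 => eta
  | t'.+1 => sub_incl (lker_submodule (injres_hom CE (i := t'.+1)))
  end.

Lemma ecosyz_ses t : exists g : 'Hom(E t, ecosyz t.+1), ses (ecosyz_in t) g.
Proof.
have dH := injres_hom CE.
have vH := @sub_incl_hom _ _ _ _ (lker_submodule (dH t.+1)).
have vI := @sub_incl_inj _ _ _ _ (lker_submodule (dH t.+1)).
have dk s x : d s.+1 (d s x) = 0.
  by apply/eqP; rewrite -memv_ker -(injres_exact CE) memv_img ?memvf.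
have [x|g gH gE] := hom_lift vH (dH t) vI.
  by apply: sub_incl_ex; rewrite memv_ker dk.
have g0 x : g x = 0 <-> d t x = 0.
  by rewrite -gE; split=> [->|/vI//]; rewrite linear0.
exists g; split=> //.
- case: t {dk vH vI g gH gE g0} => [|t]; first exact: injres_hom_eta CE.
  exact: sub_incl_hom.
- case: t {dk vH vI g gH gE g0} => [|t]; last exact: sub_incl_inj.
  by apply/lfun_injP; exact: injres_ker CE.
- move=> x; apply/g0.
  case: t {vH vI gH gE} g g0 x => [|t] g g0 x /=.
    by apply/eqP; rewrite -memv_ker -(injres_exact0 CE) memv_img ?memvf.
  by apply/eqP; rewrite -memv_ker; apply: sub_incl_mem.
- move=> y /g0.
  case: t {vH vI gH gE} g g0 y => [|t] g g0 y /eqP; rewrite -memv_ker.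
    by rewrite -(injres_exact0 CE) => /memv_imgP[x _ ->]; exists x.
  by move=> yk; apply: sub_incl_ex.
- move=> z; have : sub_incl (lker_submodule (dH t.+1)) z \in limg (d t).
    by rewrite (injres_exact CE); apply: sub_incl_mem.
  case/memv_imgP => y _ yE; exists y; apply/eqP; rewrite -subr_eq0; apply/eqP/vI.
  by rewrite linearB /= gE yE subrr.
Qed.

(** Injectivity extends the maps to [a1] and [b1]. By essentiality b1 a1 is injective, hence
    bijective, so [coterm t] is a summand of [E t]; the map induced on the next cosyzygy is onto,
    hence again injective. *)
Lemma cosyz_compare t :
  (exists (a : 'Hom(cosyz t, ecosyz t)) (b : 'Hom(ecosyz t, cosyz t)),
    [/\ rmod_hom a, rmod_hom b & forall x, b (a x) = 0 -> x = 0]) ->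
  pdim_bound t (coterm t) /\
  (exists (a : 'Hom(cosyz t.+1, ecosyz t.+1)) (b : 'Hom(ecosyz t.+1, cosyz t.+1)),
    [/\ rmod_hom a, rmod_hom b & forall x, b (a x) = 0 -> x = 0]).
Proof.
case=> a [b [aH bH baI]].
have T := cosyz_ses t; have [g' T'] := ecosyz_ses t.
have [a1 a1H a1E] := inj_ext (@injres_inj _ _ _ _ _ _ CE t) (ses_homl T)
  (hom_comp (ses_homl T') aH) (ses_inj T).
have [b1 b1H b1E] := inj_ext (@coterm_injective t) (ses_homl T')
  (hom_comp (ses_homl T) bH) (ses_inj T').
pose u := (b1 \o a1)%VF; have uH : rmod_hom u by exact: hom_comp.
have uf x : u (coterm_in t x) = coterm_in t (b (a x)).
  by rewrite comp_lfunE a1E comp_lfunE b1E comp_lfunE.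
have uI : forall x, u x = 0 -> x = 0.
  apply/lfun_injP/eqP/negPn/negP => u0.
  apply: (cosyz_essential (lker_submodule uH)); first exact/eqP.
  apply/eqP; rewrite -subv0; apply/subvP => y /memv_capP[yk /memv_imgP[x _ yE]].
  move: yk; rewrite yE memv_ker uf => /eqP/(ses_inj T)/baI->.
  by rewrite linear0 mem0v.
have uS := endo_inj_surj uI.
split.
  have [x ux|v vH vE] := hom_factor uH (hom_id (coterm t)) uS.
    by rewrite id_lfunE; apply: uI.
  refine (pdim_bound_retract a1H (hom_comp vH b1H) _ (@PE t)) => x.
  by rewrite comp_lfunE -[b1 _]comp_lfunE vE id_lfunE.
have ga := hom_comp (ses_homr T') a1H; have gb := hom_comp (ses_homr T) b1H.
have [x x0|a2 a2H a2E] := hom_factor (ses_homr T) ga (ses_surj T).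
  have [y <-] := ses_ex T x0.
  by rewrite comp_lfunE a1E comp_lfunE (ses_comp T').
have [x x0|b2 b2H b2E] := hom_factor (ses_homr T') gb (ses_surj T').
  have [y <-] := ses_ex T' x0.
  by rewrite comp_lfunE b1E comp_lfunE (ses_comp T).
exists a2, b2; split=> // x bax.
apply: (@endo_surj_inj _ _ (b2 \o a2)%VF); last by rewrite comp_lfunE.
move=> y; have [y' yE] := ses_surj T y; have [x' xE] := uS y'.
exists (coterm_out t x'); rewrite comp_lfunE a2E comp_lfunE b2E comp_lfunE.
by rewrite -[b1 _]comp_lfunE xE.
Qed.

(** The comparison starts from [P j] as a summand of [A] and carries the Auslander condition over to
    the minimal coresolution of [P j]. *)
Lemma coterm_pdim_bound t : pdim_bound t (coterm t).
Proof.
suff : exists (a : 'Hom(cosyz t, ecosyz t)) (b : 'Hom(ecosyz t, cosyz t)),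
    [/\ rmod_hom a, rmod_hom b & forall x, b (a x) = 0 -> x = 0].
  by move=> C; have [] := cosyz_compare C.
elim: t => [|t IH]; last by have [] := cosyz_compare IH.
have [p pH pE] := Pmod_retract H j.
by exists (Pincl H j), p; split=> // [|x]; [exact: Pincl_hom | rewrite pE].
Qed.

End Compare.
End Coresolution.
End Resolutions.

(** * Classes of projective and injective modules *)

Section Classes.
Variables (K : fieldType) (A : falgType K) (n : nat).
Variables (e : 'I_n -> A) (eps : 'I_n -> 'Hom(A, K^o)).
Hypothesis H : basic e eps.
Local Notation P := (Pmod H).
Local Notation I := (Imod H).
Local Notation S := (Smod H).
Local Notation R := (regular_rmodule A).
Local Notation dimv M := (dimvec e M).
Implicit Types M N X Y Z B Q : rmodule A.

Variables (E : nat -> rmodule A) (eta : 'Hom(R, E 0%N)) (dE : forall t, 'Hom(E t, E t.+1)).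
Hypothesis CE : injective_coresolution eta dE.
Hypothesis PE : forall t, pdim_bound t (E t).
Variables (D : nat) (PD : forall X, pdim_bound D X).
Variable d : 'I_n -> nat.
Hypothesis d_min : forall i t, pdim_bound t (I i) -> (d i <= t)%N.

Let Jpd j t : pdim_bound t (coterm H j t) := @coterm_pdim_bound _ _ _ _ _ H j _ _ _ CE PE t.

Lemma dimvec_family (T : finType) (F : 'I_n -> rmodule A) (c : T -> 'I_n) N
    (i : forall a, 'Hom(F (c a), N)) (p : forall a, 'Hom(N, F (c a))) k :
  dsum i p -> (dimv N k)%:Z = \sum_i #|[pred a | c a == i]|%:Z * (dimv (F i) k)%:Z.
Proof.
move=> Ds; rewrite (dimvec_dsum H k Ds) -[LHS]natz natr_sum.
rewrite (partition_big c xpredT) //=; apply: eq_bigr => i0 _.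
rewrite (eq_bigr (fun _ => (dimv (F i0) k)%:R)); last by move=> a /eqP->.
by rewrite sumr_const natz -mulr_natl natz.
Qed.

Section Projective.
Variable j : 'I_n.
Local Notation B := (cosyz H j).
Local Notation J := (coterm H j).

Let S_ t := @cosyz_ses _ _ _ _ _ H j t.
Let JI t : injective_rmodule (J t) := @coterm_injective _ _ _ _ _ H j t.

(** As pdim of [B D.+1] is at most [D], this cosyzygy splits off and is zero by minimality. The
    least [g] is idim P_j. *)
Lemma cosyz_length : exists2 g, (forall x : B g.+1, x = 0) &
  forall m, (forall x : B m.+1, x = 0) -> (g <= m)%N.
Proof.
apply: exists_min; exists D.
have [z zH zE] := coresolution_split_pdim S_ JI (@PD (B D.+1)).
exact: cosyz_split_zero zH zE.
Qed.

Section Length.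
Variable g : nat.
Hypothesis g0 : forall x : B g.+1, x = 0.
Hypothesis gmin : forall m, (forall x : B m.+1, x = 0) -> (g <= m)%N.

Lemma cosyz_top_iso : exists2 v : 'Hom(J g, B g), rmod_hom v &
  (forall x, v (coterm_in H j g x) = x) /\ (forall y, exists x, coterm_in H j g x = y).
Proof.
have fS y : exists x, coterm_in H j g x = y by apply: (ses_ex (S_ g)); apply: g0.
have [x x0|v vH vE] := hom_factor (ses_homl (S_ g)) (hom_id (B g)) fS.
  by rewrite id_lfunE; apply: (ses_inj (S_ g)).
by exists v => //; split=> // x; rewrite vE id_lfunE.
Qed.

Lemma cosyz_idim_bound s : (s <= g)%N -> idim_bound s (B (g - s)).
Proof.
elim: s => [|s IH] sg.
  have [v vH [vf _]] := cosyz_top_iso; rewrite subn0.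
  exact: idim_bound_retract (ses_homl (S_ g)) vH vf (idim_bound_injective (@JI g)).
have e1 : (g - s = (g - s.+1).+1)%N by rewrite subnSK.
apply: (idim_bound_shift (S_ (g - s.+1))); first by rewrite -e1; apply: IH; apply: ltnW.
exact: idim_bound_le (leq0n _) (idim_bound_injective (@JI (g - s.+1))).
Qed.

Lemma Pmod_idim_bound : idim_bound g (P j).
Proof. by have := cosyz_idim_bound (leqnn g); rewrite subnn. Qed.

(* Together with idim_bound g (P j) this is the left-right symmetry of the Auslander
   condition: P j can only cover modules of injective dimension at least g. *)
Lemma proj_dominates k M (q : 'Hom(M, S j)) :
  idim_bound k M -> rmod_hom q -> (forall y, exists x, q x = y) -> (g <= k)%N.
Proof.
move=> IM qH qS; rewrite leqNgt; apply/negP => kg.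
have gE : g = g.-1.+1 by rewrite prednK //; apply: leq_ltn_trans kg.
have PB : pdim_bound g.-1.+1 (B g.-1.+1).
  rewrite -gE; have [v vH [vf _]] := cosyz_top_iso.
  exact: pdim_bound_retract (ses_homl (S_ g)) vH vf (@Jpd j g).
have IM' : idim_bound g.-1 M by apply: idim_bound_le IM; rewrite -ltnS -gE.
(* The splitting for l = g - 1 kills [B g], against the choice of [g]. *)
have [z zH zE] := coresolution_split S_ JI qH (@Ptop_hom _ _ _ _ _ H j) qS (@Ptop_surj _ _ _ _ _ H j)
  (@Ptop_local _ _ _ _ _ H j) (fun s _ => @Jpd j s) PB IM'.
have := gmin (cosyz_split_zero zH zE).
by rewrite leqNgt -gE leqnn.
Qed.

(** The alternating sum is taken from the end: [s] counts the steps back from degree [g], and s = g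
    yields P_j. An I_i with d_i = g occurs only in degree [g], hence with sign (-1)^s. *)
Lemma cosyz_class s : (s <= g)%N -> exists x : 'I_n -> int,
  [/\ forall k, (dimv (B (g - s)) k)%:Z = \sum_i x i * (dimv (I i) k)%:Z,
      forall i, x i != 0 -> (d i <= g)%N &
      forall i, d i = g -> 0 <= (-1) ^+ s * x i].
Proof.
have mult t r (c : 'I_r -> 'I_n) i : is_injsum H (J t) c ->
    #|[pred a | c a == i]|%:Z != 0 -> (d i <= t)%N.
  case=> i0 [p Ds]; rewrite (eqz_nat _ 0) -lt0n => /card_gt0P[a /eqP <-].
  apply: d_min.
  refine (pdim_bound_retract (@dsum_homi _ _ _ _ _ _ _ Ds a) (@dsum_homp _ _ _ _ _ _ _ Ds a) _ (@Jpd j t)).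
  exact: (dsum_pi Ds).
elim: s => [|s IH] sg; rewrite ?subn0.
  have [r [c Ic]] := coterm_sum H j g; have [i [p Ds]] := Ic.
  exists (fun i => #|[pred a | c a == i]|%:Z); split=> [k|i0|i0 _].
  - rewrite -(dimvec_family k Ds); congr (Posz _).
    have [v vH [vf fS]] := cosyz_top_iso.
    exact: (dimvec_iso H k (ses_homl (S_ g)) (ses_inj (S_ g)) fS).
  - exact: mult Ic.
  - by rewrite expr0 mul1r.
have [x [xE xd xs]] := IH (ltnW sg).
have [r [c Ic]] := coterm_sum H j (g - s.+1); have [i [p Ds]] := Ic.
exists (fun i => #|[pred a | c a == i]|%:Z - x i); split=> [k|i0|i0 di].
- have := dimvec_ses H k (S_ (g - s.+1)); rewrite subnSK // => Ed.
  under eq_bigr => i0 _ do rewrite mulrBl.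
  by rewrite sumrB -(dimvec_family k Ds) -xE Ed PoszD addrK.
- have [->|] := eqVneq #|[pred a | c a == i0]|%:Z 0.
    by rewrite sub0r oppr_eq0; apply: xd.
  by move=> /(mult _ _ _ _ Ic) di _; apply: leq_trans di (leq_subr _ _).
- rewrite (_ : #|[pred a | c a == i0]|%:Z = 0).
    by rewrite sub0r mulrN exprS mulN1r mulNr opprK xs.
  apply/eqP/negPn/negP => /(mult _ _ _ _ Ic); rewrite di leqNgt.
  by rewrite ltn_subrL (leq_ltn_trans _ sg).
Qed.

End Length.
End Projective.

Lemma projective_data j : exists g (x : 'I_n -> int),
  [/\ idim_bound g (P j),
      forall k M (q : 'Hom(M, S j)), idim_bound k M -> rmod_hom q ->
        (forall y, exists x, q x = y) -> (g <= k)%N,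
      forall k, (dimv (P j) k)%:Z = \sum_i x i * (dimv (I i) k)%:Z,
      forall i, x i != 0 -> (d i <= g)%N &
      forall i, d i = g -> 0 <= (-1) ^+ g * x i].
Proof.
have [g g0 gmin] := cosyz_length j.
have [x [xE xd xs]] := cosyz_class g0 (leqnn g).
exists g, x; split=> //; first exact: Pmod_idim_bound g0.
  by move=> k M q IM qH qS; apply: (proj_dominates g0 gmin IM qH qS).
by move=> k; rewrite -xE subnn.
Qed.

Section Injective.
Variable g : 'I_n -> nat.
Hypothesis g_id : forall j, idim_bound (g j) (P j).
Hypothesis g_dom : forall j k M (q : 'Hom(M, S j)), idim_bound k M -> rmod_hom q ->
  (forall y, exists x, q x = y) -> (g j <= k)%N.

(** Induction along projective covers: the kernel has its bound on idim raised and its bound on pdim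
    lowered by one, so [k + s] is constant. A [P j] with g_j = k + s occurs only in the last step,
    which fixes its sign. *)
Lemma module_class s k M : idim_bound k M -> pdim_bound s M -> exists z : 'I_n -> int,
  [/\ forall l, (dimv M l)%:Z = \sum_j z j * (dimv (P j) l)%:Z,
      forall j, z j != 0 -> (g j <= k + s)%N &
      forall j, g j = (k + s)%N -> 0 <= (-1) ^+ s * z j].
Proof.
elim: s k M => [|s IH] k M IM PM.
  have [r [c [Q [i [p [phi [Ds phiH phiS phiK]]]]]]] := cover H M.
  have phiI := cover_projective Ds phiH phiS phiK PM.
  exists (fun j => #|[pred a | c a == j]|%:Z); split=> [l|j|j _].
  - by rewrite -(dimvec_family l Ds) (dimvec_iso H l phiH phiI phiS).
  - rewrite (eqz_nat _ 0) -lt0n => /card_gt0P[a /eqP <-]; rewrite addn0.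
    have [q qH qS] := cover_top a Ds phiH phiS phiK.
    exact: g_dom IM qH qS.
  - by rewrite expr0 mul1r.
have [r [c [Q [i [p [phi [Ds phiH phiS phiK]]]]]]] := cover H M.
have gk a : (g (c a) <= k)%N.
  have [q qH qS] := cover_top a Ds phiH phiS phiK.
  exact: g_dom IM qH qS.
have T := lker_ses phiH phiS.
have PQ : projective Q by apply: (dsum_projective Ds) => a; apply: Pmod_projective.
have IQ : idim_bound k.+1 Q.
  apply: (dsum_idim_bound Ds) => a; apply: idim_bound_le (@g_id (c a)).
  exact: leq_trans (gk a) (leqnSn k).
have [z [zE zg zs]] := IH k.+1 _ (idim_bound_shift T IM IQ) (proj2 (pdim_bound_step s T PQ) PM).
have q0 j : g j = (k + s.+1)%N -> #|[pred a | c a == j]|%:Z = 0.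
  move=> gj; apply/eqP; rewrite (eqz_nat _ 0) -leqn0 leqNgt; apply/negP.
  move=> /card_gt0P[a /eqP ca]; have := gk a.
  by rewrite ca gj leqNgt addnS ltnS leq_addr.
exists (fun j => #|[pred a | c a == j]|%:Z - z j); split=> [l|j|j gj].
- under eq_bigr => j0 _ do rewrite mulrBl.
  by rewrite sumrB -(dimvec_family l Ds) -zE (dimvec_ses H l T) PoszD addrC addKr.
- have [->|] := eqVneq #|[pred a | c a == j]|%:Z 0.
    by rewrite sub0r oppr_eq0 => /zg; rewrite addSnnS.
  rewrite (eqz_nat _ 0) -lt0n => /card_gt0P[a /eqP <-] _.
  exact: leq_trans (gk a) (leq_addr _ _).
- by rewrite q0 // sub0r mulrN exprS mulN1r mulNr opprK zs // addSnnS.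
Qed.

End Injective.
End Classes.

(** * Permanents *)

(* M and N are block triangular for d and g, and up to the sign s k their k-th
   diagonal blocks are mutually inverse non-negative integer matrices, that is
   permutation matrices. *)
Section Permanent.
Variables (n : nat) (M N : 'M[int]_n) (d g : 'I_n -> nat) (s : nat -> int).
Hypotheses (MN : M *m N = 1%:M) (NM : N *m M = 1%:M).
Hypothesis ss : forall k, s k * s k = 1.
Hypothesis M_supp : forall j i, M j i != 0 -> (d i <= g j)%N.
Hypothesis N_supp : forall i j, N i j != 0 -> (g j <= d i)%N.
Hypothesis M_sign : forall j i, d i = g j -> 0 <= s (g j) * M j i.
Hypothesis N_sign : forall i j, d i = g j -> 0 <= s (g j) * N i j.

(** A nonzero term forces d i = g j, so both factors lie in diagonal blocks with the same sign. *)
Let MN_ge0 j j' i : g j = g j' -> 0 <= M j i * N i j'.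
Proof.
move=> gg; have [->|Mn] := eqVneq (M j i) 0; first by rewrite mul0r.
have [->|Nn] := eqVneq (N i j') 0; first by rewrite mulr0.
have dg : d i = g j.
  by apply/eqP; rewrite eqn_leq M_supp //= gg N_supp.
have -> : M j i * N i j' = (s (g j) * M j i) * (s (g j) * N i j').
  by rewrite mulrACA ss mul1r.
by rewrite mulr_ge0 //; [exact: M_sign | rewrite gg; apply: N_sign; rewrite dg].
Qed.

Let row_sum j : \sum_i M j i * N i j = 1.
Proof. by have /matrixP/(_ j j) := MN; rewrite !mxE eqxx. Qed.

Let match_exists j : exists i, M j i * N i j == 1.
Proof.
have [i ni] : exists i, M j i * N i j != 0.
  apply/existsP; rewrite -negb_forall; apply/negP => /forallP z.
  by have := row_sum j; rewrite big1 // => i _; apply/eqP; apply: z.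
exists i; have := row_sum j; rewrite (bigD1 i) //=.
have := MN_ge0 i (erefl (g j)).
have : 0 <= \sum_(k | k != i) M j k * N k j by apply: sumr_ge0 => k _; apply: MN_ge0.
by move: ni; move: (M j i * N i j) (\sum_(k | k != i) _) => a b; lia.
Qed.

Let pi j : 'I_n := xchoose (match_exists j).
Let piE j : M j (pi j) * N (pi j) j = 1.
Proof. exact/eqP/(xchooseP (match_exists j)). Qed.

Let M_pi j : M j (pi j) != 0.
Proof. by apply/eqP => M0; have := piE j; rewrite M0 mul0r. Qed.

Let N_pi j : N (pi j) j != 0.
Proof. by apply/eqP => N0; have := piE j; rewrite N0 mulr0. Qed.

Let d_pi j : d (pi j) = g j.
Proof. by apply/eqP; rewrite eqn_leq M_supp ?N_supp. Qed.

(** A value taken twice by [pi] would make a diagonal entry of N M at least 2. *)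
Let pi_inj : injective pi.
Proof.
move=> j j' jj'; apply/eqP/negPn/negP => ne.
have /matrixP/(_ (pi j) (pi j)) := NM; rewrite !mxE eqxx (bigD1 j) //= (bigD1 j') 1?eq_sym //=.
have := piE j; have := piE j'; rewrite -jj' mulrC => -> ; rewrite mulrC => ->.
have : 0 <= \sum_(i | (i != j) && (i != j')) N (pi j) i * M i (pi j).
  by apply: sumr_ge0 => i _; rewrite mulrC; apply: MN_ge0.
by set x := \sum_(_ | _) _; lia.
Qed.

Let M_pi0 j j' : g j = g j' -> j != j' -> M j (pi j') = 0.
Proof.
move=> gg ne; have /matrixP/(_ j j') := MN; rewrite !mxE (negPf ne) => S0.
have /psumr_eq0P : forall i, xpredT i -> 0 <= M j i * N i j' by move=> i _; apply: MN_ge0.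
move/(_ S0 (pi j') isT)/eqP; rewrite mulf_eq0 (negPf (N_pi j')) orbF.
by move/eqP.
Qed.

Lemma permanent_block_triangular : permanent M = 1 \/ permanent M = -1.
Proof.
pose p := perm pi_inj.
have -> : permanent M = \prod_j M j (pi j).
  rewrite /permanent (bigD1 p) //= [X in _ + X]big1 ?addr0; first by apply: eq_bigr => j _; rewrite permE.
  move=> q qp; apply/eqP; apply: contraR qp => nz.
  have Mq j : M j (q j) != 0.
    by apply: contra nz => /eqP M0; rewrite (bigD1 j) //= M0 mul0r.
  pose t := (q * p^-1)%g.
  have qE j : q j = pi (t j) by rewrite -[RHS](permE pi_inj) /t permM permKV.
  (* If [q] contributes, [t] never increases [g]. A permutation preserves the sum of [g], so every
     value is preserved; within a block [M_pi0] then forces [t] to be trivial. *)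
  have gt j : (g (t j) <= g j)%N by rewrite -d_pi -qE M_supp.
  have Eg j : g (t j) = g j.
    have := leqif_sum (fun i (_ : xpredT i) => leqif_eq (gt i)).
    rewrite -(reindex_inj (@perm_inj _ t) (P := xpredT) (F := g)) => -[_].
    by rewrite eqxx => /esym/forallP/(_ j)/eqP.
  apply/eqP/permP => j; rewrite permE qE; congr (pi _).
  apply/eqP; apply: contraT => tj; have := Mq j.
  by rewrite qE M_pi0 ?eqxx // eq_sym.
have Mu j : M j (pi j) = 1 \/ M j (pi j) = -1.
  have /(congr1 absz)/eqP := piE j; rewrite abszM muln_eq1 => /andP[/eqP + _].
  by move: (M j (pi j)) => a; lia.
apply: (big_ind (fun x : int => x = 1 \/ x = -1)); first by left.
  by move=> x y [->|->] [->|->]; rewrite ?mulrN ?mulr1 ?opprK; tauto.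
by move=> j _; apply: Mu.
Qed.

End Permanent.

(** * The Coxeter matrix of a split basic algebra *)

Section Coxeter.
Variables (K : fieldType) (A : falgType K) (n : nat).
Variables (e : 'I_n -> A) (eps : 'I_n -> 'Hom(A, K^o)).
Hypothesis H : basic e eps.

Lemma permanent_coxeter : auslander_regular A ->
  permanent (coxeter_matrix e) = 1 \/ permanent (coxeter_matrix e) = -1.
Proof.
case=> [[E [eta [dE [[CE _] PE']]]] _ [D PD']].
have PD X : pdim_bound D X := pdim_le_bound (PD' X).
have PE t : pdim_bound t (E t) := pdim_le_bound (PE' t).
have /fin_all_exists2[d d_pd d_min] i : exists2 t, pdim_bound t (Imod H i) &
    forall s, pdim_bound s (Imod H i) -> (t <= s)%N.
  by apply: exists_min; exists D; apply: PD.
have /fin_all_exists[g /fin_all_exists[x xP]] := projective_data CE PE PD d_min.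
have g_id j : idim_bound (g j) (Pmod H j) by have [] := xP j.
have g_dom j k M q : idim_bound k M -> @rmod_hom _ _ M (Smod H j) q ->
    (forall y, exists x, q x = y) -> (g j <= k)%N.
  by have [_ + _ _ _] := xP j; apply.
have /fin_all_exists[z zP] i : exists z : 'I_n -> int, [/\
    forall l, (dimvec e (Imod H i) l)%:Z = \sum_j z j * (dimvec e (Pmod H j) l)%:Z,
    forall j, z j != 0 -> (g j <= 0 + d i)%N &
    forall j, g j = (0 + d i)%N -> 0 <= (-1) ^+ d i * z j].
  apply: (module_class g_id g_dom) (d_pd i).
  exact: idim_bound_injective (@Imod_injective _ _ _ _ _ H i).
(* Expanding the simple modules in the projectives gives a right inverse of the Cartan matrix, which
   is therefore invertible over the integers. *)
have /fin_all_exists[w wP] j : exists w : 'I_n -> int,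
    forall l, (dimvec e (Smod H j) l)%:Z = \sum_i w i * (dimvec e (Pmod H i) l)%:Z.
  have [w [wE _ _]] := module_class g_id g_dom (@pdim_idim_bound _ _ D PD (Smod H j)) (PD (Smod H j)).
  by exists w.
set om := cartan_matrix e.
have omP k j : om k j = (dimvec e (Pmod H j) k)%:Z by rewrite mxE dimvec_P.
have omI i k : om i k = (dimvec e (Imod H i) k)%:Z by rewrite mxE dimvec_I.
pose X := \matrix_(i, j) x j i; pose Z := \matrix_(j, i) z i j.
pose W := \matrix_(i, j) w j i.
have omX : om = om^T *m X.
  apply/matrixP => k j; have [_ _ xE _ _] := xP j.
  by rewrite omP xE mxE; apply: eq_bigr => i _; rewrite !mxE mulrC dimvec_I.
have omZ : om^T = om *m Z.
  apply/matrixP => l i; have [zE _ _] := zP i.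
  by rewrite mxE omI zE mxE; apply: eq_bigr => j _; rewrite omP mxE mulrC.
have omW : om *m W = 1%:M.
  apply/matrixP => l j; rewrite [LHS]mxE; transitivity (Posz (dimvec e (Smod H j) l)).
    by rewrite wP; apply: eq_bigr => i _; rewrite omP mxE mulrC.
  by rewrite dimvec_S mxE eq_sym natz.
have [omU _] := mulmx1_unit omW.
have ZX : Z *m X = 1%:M.
  apply: (can_inj (mulKmx omU)); rewrite mulmxA -omZ -omX.
  by rewrite mulmx1.
have XZ := mulmx1C ZX.
(* Transposing [omX] gives om^T = X^T om. *)
have -> : coxeter_matrix e = - X^T.
  by rewrite /coxeter_matrix -/om {1}omX trmx_mul trmxK mulmxK.
(* The block signs are - (-1)^k because both matrices carry a minus sign. *)
apply: (@permanent_block_triangular n (- X^T) (- Z^T) d g (fun k => - (-1) ^+ k)).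
- by rewrite mulNmx mulmxN opprK -trmx_mul ZX trmx1.
- by rewrite mulNmx mulmxN opprK -trmx_mul XZ trmx1.
- by move=> k; rewrite mulrNN -expr2 sqrr_sign.
- by move=> j i; rewrite !mxE oppr_eq0; have [_ _ _ + _] := xP j; apply.
- by move=> i j; rewrite !mxE oppr_eq0; have [_ + _] := zP i; apply.
- by move=> j i dg; rewrite !mxE mulrNN; have [_ _ _ _] := xP j; apply.
- by move=> i j dg; rewrite !mxE mulrNN -dg; have [_ _] := zP i; apply; rewrite dg.
Qed.

End Coxeter.

(** * Quiver algebras *)

Section PathCoefficients.
Variables (K : fieldType) (Q : quiver).
Local Notation PA := (path_algebra K Q).
Implicit Types (x y : PA) (p q r : qpath Q).

Definition coef r : PA -> K := fun x => x@_r.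

Lemma coef_lin r : linear (coef r : PA -> K^o).
Proof. by move=> c x y; rewrite /coef mcoeffD mcoeffZ. Qed.

Lemma coefD r x y : coef r (x + y) = coef r x + coef r y.
Proof. by have := coef_lin r 1 x y; rewrite !scale1r. Qed.

Lemma coefZ r c x : coef r (c *: x) = c * coef r x.
Proof. exact: mcoeffZ. Qed.

Lemma coef0 r : coef r 0 = 0.
Proof. by rewrite -(scale0r (0 : PA)) coefZ mul0r. Qed.

Lemma coef_sum r (T : Type) (l : seq T) (F : T -> PA) :
  coef r (\sum_(i <- l) F i) = \sum_(i <- l) coef r (F i).
Proof. by apply: (big_morph (coef r)) => [x y|]; [exact: coefD | exact: coef0]. Qed.

Lemma coef_path r p : coef r (pa_path K p) = (p == r)%:R.
Proof. by rewrite /coef /pa_path; exact: (etrans (mcoeffU p 1 r)). Qed.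

Lemma coef_mul r x y : coef r (x * y) =
  \sum_(p <- msupp x) \sum_(q <- msupp y) x@_p * y@_q * (qcomp p q == Some r)%:R.
Proof.
rewrite coef_sum; apply: eq_bigr => p _; rewrite coef_sum; apply: eq_bigr => q _.
rewrite coefZ; congr (_ * _); case: (qcomp p q) => [t|] /=; last exact: coef0.
by rewrite coef_path.
Qed.

Lemma coef_expand r x : coef r x = \sum_(p <- msupp x) x@_p * (p == r)%:R.
Proof.
rewrite [x in LHS]pa_expand coef_sum; apply: eq_bigr => p _.
by rewrite coefZ coef_path.
Qed.

Lemma qtriv_inj : injective (@qtriv Q).
Proof. by move=> u v /(congr1 (@qstart Q)). Qed.

Lemma qcomp_triv p q v : (qcomp p q == Some (qtriv v)) = (p == qtriv v) && (q == qtriv v).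
Proof.
apply/eqP/andP => [pq|[/eqP-> /eqP->]]; last by rewrite qcomp1p eqxx.
have := qcomp_arrows pq; have := qcomp_start pq; case/qcomp_SomeP: pq => ends _.
rewrite /qstart /qarrows /= => sv /esym/eqP; rewrite -size_eq0 size_cat addn_eq0 !size_eq0.
move=> /andP[/eqP p0 /eqP q0].
have pE : p = qtriv v.
  by apply: val_inj; rewrite /= [qpath_val p]surjective_pairing p0 -sv.
split; apply/eqP => //; apply: val_inj.
rewrite /= [qpath_val q]surjective_pairing q0; congr (_, _).
by rewrite -[LHS]/(qstart q) -ends pE.
Qed.

(** A composite is a trivial path only if both factors are, so this coefficient is a character of
    the path algebra. *)
Lemma coef_triv_mul v x y : coef (qtriv v) (x * y) = coef (qtriv v) x * coef (qtriv v) y.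
Proof.
rewrite coef_mul !coef_expand big_distrl /=; apply: eq_bigr => p _.
rewrite big_distrr /=; apply: eq_bigr => q _.
by rewrite qcomp_triv mulrACA -natrM mulnb.
Qed.

Lemma coef_supp r x : coef r x != 0 -> r \in msupp x.
Proof. by apply: contraR => /mcoeff_outdom rx; apply/eqP. Qed.

Lemma arrow_power_mul a b x y : in_arrow_ideal_power a x ->
  in_arrow_ideal_power b y -> in_arrow_ideal_power (a + b) (x * y).
Proof.
move=> ax by_ r rxy; rewrite leqNgt; apply/negP => rl.
suff r0 : coef r (x * y) = 0 by move: rxy; rewrite -mcoeff_neq0 -/(coef r (x * y)) r0 eqxx.
rewrite coef_mul big_seq big1 // => p px; rewrite big_seq big1 // => q qy.
case: eqP => [pq|_]; last by rewrite mulr0.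
move: rl; rewrite /qlength (qcomp_arrows pq) size_cat ltnNge.
by rewrite leq_add //; [exact: ax | exact: by_].
Qed.

Lemma arrow_power1 x : (forall v, coef (qtriv v) x = 0) -> in_arrow_ideal_power 1 x.
Proof.
move=> x0 p px; rewrite lt0n; apply/negP; rewrite /qlength size_eq0 => /eqP p0.
have pE : p = qtriv (qstart p).
  by apply: val_inj; rewrite /= [qpath_val p]surjective_pairing -/(qarrows p) p0.
by move: px; rewrite -mcoeff_neq0 -/(coef p x) pE x0 eqxx.
Qed.

End PathCoefficients.

(** * Quiver algebras are split basic *)

Section Presentation.
Variables (K : fieldType) (Q : quiver) (I : path_algebra K Q -> Prop) (A : falgType K).
Variable pi : {linear path_algebra K Q -> A}.
Hypotheses (I_adm : admissible_ideal I) (A_KQI : presents I pi).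
Variables (n : nat) (s : 'I_n -> vertex Q).
Hypothesis s_bij : bijective s.
Local Notation PA := (path_algebra K Q).
Implicit Types x y : PA.

Let pi1 : pi 1 = 1. Proof. by case: A_KQI => -[]. Qed.
Let piM x y : pi (x * y) = pi x * pi y. Proof. by case: A_KQI => -[]. Qed.
Let pi_surj a : exists x, pi x = a. Proof. by case: A_KQI. Qed.
Let pi_ker x : pi x = 0 <-> I x. Proof. by case: A_KQI. Qed.

Let sect (a : A) : PA := sval (boolp.cid (pi_surj a)).
Let sectK a : pi (sect a) = a. Proof. exact: proj2_sig (boolp.cid (pi_surj a)). Qed.

(** Elements of an admissible ideal involve no path of length 0, so the characters descend to the
    quotient. *)
Let ker_coef v x : pi x = 0 -> coef (qtriv v) x = 0.
Proof.
move=> /pi_ker Ix; have [_ I2 _] := I_adm.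
apply/eqP; apply: contraT => /coef_supp /(I2 x Ix).
by [].
Qed.

Let coef_pi v x y : pi x = pi y -> coef (qtriv v) x = coef (qtriv v) y.
Proof.
move=> xy; apply/eqP; rewrite -subr_eq0 -[X in _ + X]mulN1r -coefZ -coefD scaleN1r.
by apply/eqP/ker_coef; rewrite linearB /= xy subrr.
Qed.

Let eps_fun v (a : A) : K^o := coef (qtriv v) (sect a).

Let eps_lin v : linear (eps_fun v).
Proof.
move=> c a b; rewrite /eps_fun -coef_lin; apply: coef_pi.
by rewrite linearP /= !sectK.
Qed.

Definition vertex_char (i : 'I_n) : 'Hom(A, K^o) := lfun_of (eps_lin (s i)).

Lemma vertex_charE i x : vertex_char i (pi x) = coef (qtriv (s i)) x.
Proof. by rewrite lfun_ofE; apply: coef_pi; rewrite sectK. Qed.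

Lemma presents_basic : basic (fun i => pi (pa_idem K (s i))) vertex_char.
Proof.
have [t sK tK] := s_bij.
have idem_mul u v : pa_idem K u * pa_idem K v = if u == v then pa_idem K u else 0 :> PA.
  rewrite [LHS]pa_mulU qcomp1p /qstart /=.
  by case: eqP => [->|_].
split.
- rewrite -linear_sum -pi1; congr (pi _); rewrite [RHS]/1 /= /pa_one.
  by rewrite [RHS](reindex s) //=; exists t => x _.
- move=> i j; rewrite -piM idem_mul (inj_eq (can_inj sK)).
  by case: ifP => _; rewrite ?linear0.
- move=> i; rewrite -pi1 vertex_charE.
  rewrite /GRing.one /= /pa_one coef_sum (bigD1 (s i)) //= coef_path eqxx.
  rewrite big1 ?addr0 // => v /negPf vs.
  by rewrite coef_path (inj_eq (@qtriv_inj Q)) vs.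
- move=> i a b; rewrite -[a]sectK -[b]sectK -piM !vertex_charE.
  exact: coef_triv_mul.
- move=> i j; rewrite vertex_charE coef_path.
  by rewrite (inj_eq (@qtriv_inj Q)) (inj_eq (can_inj sK)) eq_sym.
have [_ _ [m m2 Im]] := I_adm.
exists m.-1; rewrite prednK; last exact: ltnW.
have lift a : a \in radv vertex_char -> exists2 x, pi x = a & in_arrow_ideal_power 1 x.
  move=> aJ; exists (sect a) => //; apply: arrow_power1 => v.
  by rewrite -[v]tK -vertex_charE sectK; apply/mem_radvP.
apply/eqP; rewrite -subv0; apply/subvP => a aJ; rewrite memv0; apply/eqP.
(* The factors of J^m are peeled off one at a time: J^k annihilates the image of the (m - k)-th
   power of the arrow ideal. The case k = 0 is admissibility, and k = m is applied to 1. *)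
suff H k : (k <= m)%N -> forall z, in_arrow_ideal_power (m - k) z ->
    forall a, a \in (radv vertex_char ^+ k)%VS -> a * pi z = 0.
  by rewrite -[a]mulr1 -pi1; apply: (H m) => //; rewrite subnn.
elim: k => [|k IH] km z zP b.
  rewrite expv0 => /vlineP[c ->]; rewrite subn0 in zP.
  by have /pi_ker -> := Im z zP; rewrite mulr0.
rewrite expvSr => bJ; apply/eqP.
have -> : (b * pi z == 0) = (b \in lker (amulr (pi z))) by rewrite memv_ker lfunE.
move: b bJ; apply/subvP/prodvP => u v uJ /lift[x <- x1].
rewrite memv_ker lfunE /= -mulrA -piM; apply/eqP.
apply: IH (ltnW km) _ _ _ uJ.
have -> : (m - k = 1 + (m - k.+1))%N by rewrite add1n subnSK.
exact: arrow_power_mul.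
Qed.

End Presentation.

Theorem corollary1p3 (K : fieldType) (Q : quiver)
    (I : path_algebra K Q -> Prop) (A : falgType K)
    (pi : {linear path_algebra K Q -> A})
    (I_adm : admissible_ideal I) (A_KQI : presents I pi)
    (A_reg : auslander_regular A)
    (n : nat) (s : 'I_n -> vertex Q) (s_bij : bijective s) :
  let C := coxeter_matrix (fun i => pi (pa_idem K (s i))) in
  permanent C = 1 \/ permanent C = -1.
Proof.
exact: permanent_coxeter (presents_basic I_adm A_KQI s_bij) A_reg.
Qed.
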